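(* Let $K$ be a finite field of order $q>2$. Let $G$ be a bipartite graph and let $\mathcal{I}$ and $\mathcal{P}$ be two open ears of $G$ sharing the same end-vertices. Let $G^\flat$ denote the graph $G-\mathcal{P}^\circ$ if $\ell(\mathcal{P})>1$, or the graph $G\setminus E_{\mathcal{P}}$ (delete the edge of $\mathcal{P}$, keep all vertices) if $\ell(\mathcal{P})=1$. Assume that $G^\flat$ satisfies the bipartite ear modification hypothesis on $\mathcal{I}$. Then $$\operatorname{reg} G = \operatorname{reg} G^\flat + \Bigl\lfloor \tfrac{\ell(\mathcal{P})}{2}\Bigr\rfloor (q-2).$$
   Context: Graphs are simple (finite, undirected, no loops, no multiple edges) and have no isolated vertices. $V_G$, $E_G$ denote the vertex and edge sets of $G$. Regularity of a graph: $K$ is a finite field of order $q>2$. $K[E_G]$ is the polynomial ring over $K$ with one variable $t_{ij}$ for each edge $\{i,j\}\in E_G$ (standard grading). The vanishing ideal over $G$, $I_q(G)\subset K[E_G]$, is the ideal generated by the homogeneous polynomials $f\in K[E_G]$ which vanish after substituting each variable $t_{ij}$ by $a_ia_j$, for all choices of $a_i\in K^*=K\setminus\{0\}$, $i\in V_G$. (Equivalently, it is the vanishing ideal of the image of the projective torus under $t_{ij}\mapsto x_ix_j$.) $\operatorname{reg} G$ denotes the Castelnuovo–Mumford regularity of the graded $K[E_G]$-module $K[E_G]/I_q(G)$, i.e. $\max\{j-i:\beta_{ij}\neq 0\}$ with $\beta_{ij}$ its graded Betti numbers. (This quotient is Cohen–Macaulay of dimension one, so $\operatorname{reg} G$ is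 also the least integer from which its Hilbert function equals its Hilbert polynomial.) Paths: a path $\mathcal{P}\subset G$ is a subgraph with an ordering of its vertices $v_0,v_1,\dots,v_\ell$, $\ell>0$, such that $v_1,\dots,v_\ell$ are distinct, $v_0,\dots,v_{\ell-1}$ are distinct, and $E_{\mathcal{P}}$ consists of the $\ell$ distinct edges $\{v_i,v_{i+1}\}$, $0\le i\le \ell-1$; $v_0=v_\ell$ is allowed (then $\mathcal P$ is a cycle, $\ell\geq 3$). The inner vertices are $v_1,\dots,v_{\ell-1}$, and their set is denoted $\mathcal{P}^\circ$; the end-vertices are $v_0$ and $v_\ell$; the length is $\ell(\mathcal{P})=\ell$. A path $\mathcal{P}\subset G$ is an ear of $G$ if all its inner vertices have degree two in $G$; it is an open ear if its end-vertices are distinct. Bipartite ear modification: let $H$ be a bipartite graph and $\mathcal{I}\subset H$ an open ear of $H$. A bipartite ear modification of $H$ along $\mathcal{I}$ is the simple graph $H'$ (multiple edges created are removed) obtained by either (i) replacing $\mathcal{I}$ by another open ear (a new path, whose inner vertices are new vertices) with the same end-vertices and with length of the same parity as $\ell(\mathcal{I})$, or (ii) if $\ell(\mathcal{I})$ is even, identifying the two end-vertices of $\mathcal{I}$ in $H-\mathcal{I}^\circ$. We say that $H$ satisfies the bipartite ear modification hypothesis on $\mathcal{I}$ if for every bipartite ear modification $H'$ of $H$ along $\mathcal{I}$, $$\operatorname{reg} H' = \operatorname{reg} H + \tfrac{|V_{H'}|-|V_H|}{2}(q-2).$$ *)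

(* Defs.v *)
From mathcomp Require Import all_boot all_order all_algebra.
From mathcomp Require Import mpoly.
From Stdlib Require Import ClassicalEpsilon.

Set Implicit Arguments.
Unset Strict Implicit.
Unset Printing Implicit Defensive.

Import GRing.Theory.
Local Open Scope ring_scope.

(** * Graphs *)

(* An edge {x, y} is the set [set x; y]; the ambient type V may be larger than
   the vertex set, so that subgraphs of G live over the same V as G. *)
Record graph (V : finType) := Graph {
  vset : {set V};
  eset : {set {set V}}
}.

Section Graphs.
Variable V : finType.
Implicit Types (G H : graph V) (p : V * seq V).

Definition simple_graph G : Prop :=
  forall e, e \in eset G -> e \subset vset G /\ #|e| = 2%N.

Definition no_isolated_vertex G : Prop :=
  forall x, x \in vset G -> exists2 e, e \in eset G & x \in e.

Definition bipartite G : Prop :=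
  exists c : V -> bool, forall x y, [set x; y] \in eset G -> c x != c y.

Definition degree G (x : V) : nat := #|[set e in eset G | x \in e]|.

Definition del_vertices G (A : {set V}) : graph V :=
  Graph (vset G :\: A) [set e in eset G | [disjoint e & A]].

Definition del_edges G (E : {set {set V}}) : graph V :=
  Graph (vset G) (eset G :\: E).

(* The pair (v_0, [:: v_1; ...; v_l]) stands for the path v_0, v_1, ..., v_l. *)
Definition path_length p : nat := size p.2.
Definition path_first p : V := p.1.
Definition path_last p : V := last p.1 p.2.
Definition path_ends p : {set V} := [set path_first p; path_last p].
Definition path_inner p : {set V} := [set x in behead (belast p.1 p.2)].
Definition path_edges p : seq {set V} :=
  pairmap (fun x y => [set x; y]) p.1 p.2.

(* The case v_0 = v_l is allowed. *)
Definition is_path G p : bool :=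
  [&& (0 < path_length p)%N, uniq p.2, uniq (belast p.1 p.2),
      uniq (path_edges p) & all (mem (eset G)) (path_edges p)].

Definition ear G p : Prop :=
  is_path G p /\ forall x, x \in path_inner p -> degree G x = 2%N.

Definition open_ear G p : Prop := ear G p /\ path_first p != path_last p.

(* This is G - P° if l(P) > 1 and G \ E_P if l(P) = 1. *)
Definition remove_ear G p : graph V :=
  if (1 < path_length p)%N then del_vertices G (path_inner p)
  else del_edges G [set e in path_edges p].

(* The vertex v is merged into u. Parallel edges collapse because edges form a
   set. No loop arises when u and v lie in the same class of a bipartition, as
   the end-vertices of a path of even length do. *)
Definition identify G (u v : V) : graph V :=
  let f x := if x == v then u else x in
  Graph [set f x | x in vset G] [set f @: (e : {set V}) | e in eset G].

(* The m new vertices are the [inr k]; the new path has length m.+1. *)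
Definition new_path p (m : nat) : (V + 'I_m) * seq (V + 'I_m) :=
  (inl (path_first p),
   rcons [seq inr k | k <- enum 'I_m] (inl (path_last p))).

End Graphs.

Definition replace_ear (V : finType) (H : graph V) (p : V * seq V) (m : nat) :
    graph (V + 'I_m)%type :=
  let H0 := remove_ear H p in
  Graph ([set inl x | x in vset H0] :|: [set inr k | k : 'I_m])
        ([set inl @: (e : {set V}) | e in eset H0]
           :|: [set e in path_edges (new_path p m)]).

Inductive ear_modification (V : finType) (H : graph V) (p : V * seq V) :
    forall W : finType, graph W -> Prop :=
| EarReplaced (m : nat) :
    odd m.+1 = odd (path_length p) ->
    ear_modification H p (replace_ear H p m)
| EarIdentified :
    ~~ odd (path_length p) ->
    ear_modification H p
      (identify (remove_ear H p) (path_first p) (path_last p)).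

(** * Graded Betti numbers and regularity *)

(* [m] is the dimension of the quotient of the subspace Z of U by its subspace
   B: there are m elements of Z whose classes form a basis of Z / B. *)
Definition is_quotient_dim (F : fieldType) (U : lmodType F) (Z B : U -> Prop)
    (m : nat) : Prop :=
  exists x : 'I_m -> U, (forall k, Z (x k)) /\
    forall z, Z z -> exists! a : {ffun 'I_m -> F}, B (z - \sum_k a k *: x k).

Section Betti.
Variables (F : fieldType) (n : nat).
Local Notation S := {mpoly F[n]}.
Implicit Types (J : S -> Prop) (i j : nat).

(* The Koszul complex of the variables of S is the minimal graded free
   resolution of F over S; its term in homological degree i has a basis e_s,
   of degree i, indexed by the subsets s of the variables with i elements.
   Hence Tor_i(S/J, F)_j is the homology at (i, j) of this complex tensored
   with S/J. The chains over S/J are represented by chains over S, to be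
   considered modulo J coefficientwise. *)
Local Notation koszul := {ffun {set 'I_n} -> S}.

Definition koszul_chain i j (c : koszul) : Prop :=
  forall s, c s != 0 -> [/\ #|s| = i, (i <= j)%N & c s \is (j - i).-homog].

Definition koszul_diff (c : koszul) : koszul :=
  [ffun s : {set 'I_n} => \sum_(v | v \notin s)
     (-1) ^+ #|[set u in s | (u < v)%N]| * 'X_v * c (v |: s)].

Definition koszul_cycle J i j (c : koszul) : Prop :=
  koszul_chain i j c /\ forall s, J (koszul_diff c s).

Definition koszul_boundary J i j (c : koszul) : Prop :=
  koszul_chain i j c /\
  exists2 b, koszul_chain i.+1 j b & forall s, J (c s - koszul_diff b s).

End Betti.

Section Regularity.
Variables (F : fieldType) (n : nat).
Local Notation S := {mpoly F[n]}.

(* beta_{ij}(S/J) = dim Tor_i(S/J, F)_j, for a homogeneous ideal J. The scalar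
   action of F on Koszul chains is the coefficientwise one. *)
Definition betti (J : S -> Prop) (i j : nat) : nat :=
  epsilon (inhabits 0%N)
    (@is_quotient_dim F {ffun {set 'I_n} -> S}
       (koszul_cycle J i j) (koszul_boundary J i j)).

(* r = max {j - i : beta_{ij} <> 0}; since S/J lives in degrees >= 0, only
   j >= i matter. *)
Definition is_regularity (J : S -> Prop) (r : nat) : Prop :=
  (exists i, betti J i (i + r) <> 0%N) /\
  (forall i j, betti J i j <> 0%N -> (j <= i + r)%N).

Definition regularity (J : S -> Prop) : nat :=
  epsilon (inhabits 0%N) (is_regularity J).

Definition ideal_generated (P : S -> Prop) (f : S) : Prop :=
  exists (m : nat) (h g : 'I_m -> S),
    (forall k, P (g k)) /\ f = \sum_k h k * g k.

End Regularity.

Section GraphRegularity.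
Variables (K : finFieldType) (V : finType).
Implicit Type G : graph V.

(* The variable of index i corresponds to the edge [enum_val i], and
   [\prod_(x in e) a x] is a_x a_y when e = {x, y}. *)
Definition homog_vanishing G (f : {mpoly K[#|eset G|]}) : Prop :=
  (exists d : nat, f \is d.-homog) /\
  forall a : V -> K, (forall x, x \in vset G -> a x != 0) ->
    f.@[fun i : 'I_#|eset G| => \prod_(x in enum_val i) a x] = 0.

Definition vanishing_ideal G : {mpoly K[#|eset G|]} -> Prop :=
  ideal_generated (@homog_vanishing G).

Definition reg G : nat := regularity (@vanishing_ideal G).

End GraphRegularity.

(* The difference |V_{H'}| - |V_H| may be negative, whence the equality in rat. *)
Definition ear_modification_hypothesis (K : finFieldType) (V : finType)
    (H : graph V) (p : V * seq V) : Prop :=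
  open_ear H p /\
  forall (W : finType) (H' : graph W), ear_modification H p H' ->
    (reg K H')%:R = (reg K H)%:R
      + (#|vset H'|%:R - #|vset H|%:R) / 2%:R * (#|K|%:R - 2%:R) :> rat.

(* Main.v *)
(* Since K^* is cyclic of order N = q - 1, two monomials of the same degree agree
   modulo I_q(G) iff the edge multiplicities they give to each vertex are
   congruent modulo N.  For G bipartite these congruences determine the degree
   modulo N, and if M is the least degree that suffices to represent every weight
   vector, then reg G = M - (q - 2): multiplication by an edge variable is
   injective on K[E_G]/I_q(G), it is onto from degree d - 1 to degree d exactly
   when d > M - (q - 2), and dividing Koszul chains by that variable detects the
   top nonzero Betti number.

   Labels on an ear with prescribed weights at its inner vertices form a single
   orbit under alternately adding t and subtracting t, so an ear enters M only
   through the cost f(t) of its shifted labels.  Upper bound: the best joint cost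
   of I and P is dominated by the cost of a single ear of length
   l(I) + 2 floor(l(P)/2), obtained by concatenating I, shifted, with P, minus one
   edge of P on which the optimal shift vanishes if l(P) is odd.  Lower bound: the
   labels 0, -1, 0, -1, ... on an ear cost N - 1 per pair of edges for every
   shift, which reduces I and P to an identification of their end-vertices (even
   lengths) or to a single edge (odd lengths). *)

Require Import Defs.
From mathcomp Require Import all_boot all_order all_algebra.
From mathcomp Require Import fingroup cyclic finfield mpoly ring zify.
From Stdlib Require Import ClassicalEpsilon.

Set Implicit Arguments.
Unset Strict Implicit.
Unset Printing Implicit Defensive.

Import Order.TTheory GRing.Theory Num.Theory.
Local Open Scope ring_scope.

(** * Alternating shifts of residue lists *)

Section Residues.
Variable k : nat.
Local Notation Z := 'Z_k.+2.
Implicit Types (a b t : Z) (l : seq Z).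

Lemma val_Zp_le a : (val a <= k.+1)%N.
Proof. by rewrite -ltnS (ltn_ord a). Qed.

Lemma val_addZp_le a b : (val (a + b)%R <= val a + val b)%N.
Proof. exact: leq_mod. Qed.

Lemma Zp_natr_eq (m n : nat) : (m%:R == n%:R :> Z) = (m == n %[mod k.+2]).
Proof. by rewrite !Zp_nat. Qed.

Lemma val_Zp_natr_le (m : nat) : (val (m%:R : Z)%R <= m)%N.
Proof. by rewrite Zp_nat; apply: leq_mod. Qed.

(** The two residues add up to [-1], whose least representative is [k.+1]. *)
Lemma val_addZpN1 t : (k.+1 <= val t + val (-1 - t : Z)%R)%N.
Proof.
apply: leq_trans (val_addZp_le _ _); rewrite addrC subrK.
suff -> : -1 = k.+1%:R :> Z by rewrite Zp_nat /= modn_small.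
by apply/eqP; rewrite eq_sym -subr_eq0 opprK natr1 -[0]/(0%:R) Zp_natr_eq modnn mod0n.
Qed.

Lemma val_subZp1 a : a != 0 -> (val (a - 1)%R < val a)%N.
Proof.
move=> a0; have a_gt0 : (0 < val a)%N by rewrite lt0n.
have -> : a - 1 = (val a).-1%:R :> Z.
  by apply/eqP; rewrite subr_eq natr1 prednK // natr_Zp.
by apply: leq_ltn_trans (val_Zp_natr_le _) _; rewrite ltn_predL.
Qed.

(** On the edges of a path, these are the changes of labels that preserve the weight at every inner
    vertex. *)
Fixpoint altshift l t := if l is x :: l' then (x + t) :: altshift l' (- t) else [::].

Definition lcost l := (\sum_(x <- l) val x)%N.

Lemma lcost_nil : lcost [::] = 0%N.
Proof. by rewrite /lcost big_nil. Qed.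

Lemma lcost_cons x l : lcost (x :: l) = (val x + lcost l)%N.
Proof. by rewrite /lcost big_cons. Qed.

Lemma lcost_cat l1 l2 : lcost (l1 ++ l2) = (lcost l1 + lcost l2)%N.
Proof. by rewrite /lcost big_cat. Qed.

Lemma lcost_rev l : lcost (rev l) = lcost l.
Proof. by rewrite /lcost (perm_big l) //= perm_rev. Qed.

Lemma lcost_le l : (lcost l <= size l * k.+1)%N.
Proof.
elim: l => [|x l IHl]; first by rewrite lcost_nil.
by rewrite lcost_cons mulSn leq_add // val_Zp_le.
Qed.

Lemma size_altshift l t : size (altshift l t) = size l.
Proof. by elim: l t => //= x l IHl t; rewrite IHl. Qed.

Lemma altshift0 l : altshift l 0 = l.
Proof. by elim: l => //= x l IHl; rewrite addr0 oppr0 IHl. Qed.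

Lemma altshiftD l t u : altshift (altshift l t) u = altshift l (t + u).
Proof. by elim: l t u => //= x l IHl t u; rewrite IHl -opprD addrA. Qed.

Lemma altshift_cat l1 l2 t :
  altshift (l1 ++ l2) t = altshift l1 t ++ altshift l2 ((-1) ^+ size l1 * t).
Proof.
elim: l1 t => [|x l1 IHl] t /=; first by rewrite expr0 mul1r.
by rewrite IHl exprS; congr (_ :: _ ++ altshift _ _); ring.
Qed.

Lemma altshift_rev l t :
  altshift (rev l) t = rev (altshift l (- (-1) ^+ size l * t)).
Proof.
elim: l t => [|x l IHl] t //=.
rewrite !rev_cons -!cats1 altshift_cat IHl size_rev /= exprS.
by congr (rev (altshift _ _) ++ [:: _ + _]); ring.
Qed.

Lemma sum_altshift l t :
  \sum_(x <- altshift l t) x = \sum_(x <- l) x + (odd (size l))%:R * t.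
Proof.
elim: l t => [|x l IHl] t /=; first by rewrite !big_nil mul0r addr0.
by rewrite !big_cons IHl; case: (odd _) => /=; ring.
Qed.

Lemma lcost_natr l : (lcost l)%:R = \sum_(x <- l) x :> Z.
Proof. by rewrite /lcost natr_sum; apply: eq_bigr => x _; rewrite natr_Zp. Qed.

(** Passing from [t] to [t - 1] takes one off each entry at an even position (counted from 0),
    nonzero by assumption, and adds at most one to each entry at an odd position; even length pairs
    them up. *)
Lemma lcost_altshift_le l t : ~~ odd (size l) ->
  (forall l1 x l2, l = l1 ++ x :: l2 -> ~~ odd (size l1) -> x + t != 0) ->
  (lcost (altshift l (t - 1)%R) <= lcost (altshift l t))%N.
Proof.
have [n] := ubnP (size l); elim: n l => // n IHn [|x [|y l]] //= lt_ln odd_l nz.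
rewrite !lcost_cons !opprK !addnA leq_add //.
  have := val_subZp1 (nz [::] x (y :: l) erefl isT).
  have := val_addZp_le (y - t) 1; have -> : val (1 : Z) = 1%N by [].
  rewrite -!addrA [- (t - 1)]opprD opprK.
  by move: (val _) (val _) (val _) (val _) => *; lia.
apply: IHn => //; first by lia.
  by rewrite negbK in odd_l.
move=> l1 z l2 def_l odd_l1; apply: (nz (x :: y :: l1) z l2); last by rewrite /= negbK.
by rewrite def_l.
Qed.

(** The cost represents the sum modulo [k.+2], and in even length the shifts cancel in the sum. *)
Lemma lcost_altshift_modeq l t s : ~~ odd (size l) ->
  lcost (altshift l t) = lcost (altshift l s) %[mod k.+2].
Proof.
move=> /negbTE odd_l; apply/eqP; rewrite -Zp_natr_eq !lcost_natr !sum_altshift.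
by rewrite odd_l !mul0r.
Qed.

(** Each pair becomes [t], [-1 - t], so no shift makes this labelling cheaper. *)
Lemma lcost_altshift_pairs n t :
  (n * k.+1 <= lcost (altshift (flatten (nseq n [:: 0; -1 : Z]%R)) t))%N.
Proof.
elim: n t => //= n IHn t; rewrite mulSn !lcost_cons opprK addnA add0r leq_add //.
exact: val_addZpN1.
Qed.

Lemma size_pairs n : size (flatten (nseq n [:: 0; -1 : Z])) = n.*2.
Proof. by elim: n => //= n ->. Qed.

(* If [z] sits at an even position of a list of odd length and vanishes at a
   minimiser [t], then it can be deleted: the cost of the remaining list is
   constant modulo [k.+2], and it is within [k.+1] of the minimum. *)
Lemma lcost_altshift_drop l1 z l2 t s :
    ~~ odd (size l1) -> ~~ odd (size l2) -> z + t = 0 ->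
    (forall r, (lcost (altshift (l1 ++ z :: l2) t)
                  <= lcost (altshift (l1 ++ z :: l2) r))%N) ->
  (lcost (altshift (l1 ++ z :: l2) t)
     <= lcost (altshift l1 s) + lcost (altshift l2 (- s)%R))%N.
Proof.
move=> odd1 odd2 zt /(_ s); rewrite !altshift_cat -signr_odd (negbTE odd1) !mul1r.
rewrite !lcost_cat /= !lcost_cons zt add0n => le_ts.
have eq1 := lcost_altshift_modeq t s odd1.
have eq2 := lcost_altshift_modeq (- t) (- s) odd2.
have eq12 : (lcost (altshift l1 t) + lcost (altshift l2 (- t)%R) =
    lcost (altshift l1 s) + lcost (altshift l2 (- s)%R) %[mod k.+2])%N.
  by rewrite -modnDm eq1 eq2 modnDm.
move: eq12 le_ts.
set A := (_ + _)%N; rewrite addnCA; set B := (_ + _)%N => eqAB le_AB.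
have {}le_AB : (A <= k.+1 + B)%N by apply: leq_trans le_AB _; rewrite leq_add2r val_Zp_le.
case: (leqP A B) => // lt_BA.
have /dvdn_leq : (k.+2 %| A - B)%N by rewrite -eqn_mod_dvd // 1?ltnW //; apply/eqP.
by rewrite subn_gt0 => /(_ lt_BA); lia.
Qed.

(** The list [chi] labels a single ear which, at every shift [s], costs at least as much as [xi] and
    [zeta] under suitable shifts of total [s]. The shift of [zeta] is kept at an optimal [t]
    throughout. *)
Lemma lcost_altshift_merge (xi zeta : seq Z) :
    odd (size xi) = odd (size zeta) ->
  exists2 chi, size chi = (size xi + (size zeta)./2.*2)%N &
    forall s, exists t t', t + t' = s /\
      (lcost (altshift xi t) + lcost (altshift zeta t')
         <= lcost (altshift chi s))%N.
Proof.
move=> odd_xz.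
have [t min_t] : exists t, forall r,
    (lcost (altshift zeta t) <= lcost (altshift zeta r))%N.
  case: (@arg_minnP _ 0 xpredT (fun t => lcost (altshift zeta t)) isT) => t _ min_t.
  by exists t => r; apply: min_t.
case odd_z: (odd (size zeta)) odd_xz => odd_x; last first.
  (* Under the shift [s] of the concatenation, [xi] is shifted by [s - t], and [zeta] is charged its
     cost at [s], at least that at [t]. *)
  exists (altshift xi (- t) ++ zeta).
    by rewrite size_cat size_altshift even_halfK // odd_z.
  move=> s; exists (s - t), t; split; first by rewrite subrK.
  rewrite altshift_cat altshiftD size_altshift -signr_odd odd_x mul1r lcost_cat.
  by rewrite addrC leq_add.
(* Were no entry at an even position zero at [t], the shift [t - 1] would be strictly cheaper, since
   even positions outnumber odd ones by one. *)
have [l1 [z [l2 [def_z odd1 zt]]]] : exists l1 z l2,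
    [/\ zeta = l1 ++ z :: l2, ~~ odd (size l1) & z + t = 0].
  apply: NNPP => no_z; have := min_t (t - 1); apply/negP; rewrite -ltnNge.
  have nz l1 x l2 : zeta = l1 ++ x :: l2 -> ~~ odd (size l1) -> x + t != 0.
    by move=> def_z odd1; apply/eqP => xt; case: no_z; exists l1, x, l2.
  case/lastP: zeta odd_z nz {min_t no_z odd_x} => // l x; rewrite size_rcons /= => odd_l nz.
  rewrite -cats1 !altshift_cat -signr_odd (negbTE odd_l) !mul1r !lcost_cat /=.
  rewrite !lcost_cons lcost_nil !addn0 -addnS leq_add //.
    apply: lcost_altshift_le => // l1 y l2 def_l odd1.
    by apply: (nz l1 y (rcons l2 x)) => //; rewrite def_l rcons_cat.
  by rewrite addrA val_subZp1 // (nz l x [::]) ?cats1.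
have odd2 : ~~ odd (size l2).
  by move: odd_z; rewrite def_z size_cat /= addnS /= oddD (negbTE odd1).
(* The vanishing entry [z] is deleted. As [xi] has odd length, [l2] is shifted by [- s], as it would
   be inside [zeta]; reversing [l1], of even length, turns its shift [- s] into [s]. *)
exists (altshift xi (- t) ++ l2 ++ rev l1).
  rewrite !size_cat size_altshift size_rev def_z size_cat /= addnS.
  by rewrite -uphalfE uphalf_half oddD (negbTE odd1) (negbTE odd2) even_halfK
     ?oddD ?(negbTE odd1) ?(negbTE odd2) // [(size l2 + _)%N]addnC.
move=> s; exists (s - t), t; split; first by rewrite subrK.
rewrite !altshift_cat altshiftD size_altshift -signr_odd odd_x !lcost_cat expr1 mulN1r.
rewrite addrC leq_add // altshift_rev lcost_rev.
rewrite -![_ ^+ size _]signr_odd (negbTE odd1) (negbTE odd2) !mul1r mulN1r opprK addnC.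
by rewrite def_z; apply: lcost_altshift_drop => //; rewrite -?def_z.
Qed.
End Residues.

(** * Edge labellings modulo q - 1 *)

Section Words.
Variables (k : nat) (V : finType).
Local Notation Z := 'Z_k.+2.
Local Notation word := (seq ({set V} * Z)).
Implicit Types (E : {set {set V}}) (w : word) (D : V -> Z) (xi : seq Z).

Definition over E w := all (fun a => a.1 \in E) w.

(** Modulo q - 1, this is the exponent of the coordinate at [z] once each edge variable is replaced
    by the product of its end coordinates. *)
Definition weight w (z : V) : Z := \sum_(a <- w | z \in a.1) a.2.

Definition wsum w : Z := \sum_(a <- w) a.2.

Definition wcost w := lcost (unzip2 w).

(** The term [D] is the part of the weight supplied elsewhere, for instance by shifting the labels
    of an ear. *)
Definition reaches E w D c := exists w',
  [/\ over E w', forall z, weight w' z + D z = weight w z & (wcost w' <= c)%N].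

(** The least such [B] is the covering radius that determines the regularity. *)
Definition reduces E B := forall w, over E w -> reaches E w (fun=> 0) B.

Definition graded E := forall w w',
  over E w -> over E w' -> weight w =1 weight w' -> wsum w = wsum w'.

Lemma over_cat E w1 w2 : over E (w1 ++ w2) = over E w1 && over E w2.
Proof. exact: all_cat. Qed.

Lemma over_sub E1 E2 w : {subset E1 <= E2} -> over E1 w -> over E2 w.
Proof. by move=> sE; apply: sub_all => a; apply: sE. Qed.

Lemma over_zip E (s : seq {set V}) xi : {subset s <= E} -> over E (zip s xi).
Proof.
elim: s xi => [|e s IHs] [|x xi] //= sE; rewrite sE ?mem_head //=.
by apply: IHs => y s_y; apply: sE; rewrite inE s_y orbT.
Qed.

Lemma weight_cat w1 w2 z : weight (w1 ++ w2) z = weight w1 z + weight w2 z.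
Proof. by rewrite /weight big_cat. Qed.

Lemma weight_cons e (x : Z) w z : weight ((e, x) :: w) z = (z \in e)%:R * x + weight w z.
Proof. by rewrite /weight big_cons; case: (z \in e); rewrite ?mul1r ?mul0r ?add0r. Qed.

Lemma weight_nil z : weight [::] z = 0.
Proof. by rewrite /weight big_nil. Qed.

Lemma weight_over_out E w z :
  over E w -> (forall e, e \in E -> z \notin e) -> weight w z = 0.
Proof.
move=> w_E nz; rewrite /weight big_seq_cond big_pred0 // => a.
by case: (boolP (a \in w)) => //= /(allP w_E)/nz/negPf.
Qed.

Lemma wsum_cat w1 w2 : wsum (w1 ++ w2) = wsum w1 + wsum w2.
Proof. by rewrite /wsum big_cat. Qed.

Lemma wcost_cat w1 w2 : wcost (w1 ++ w2) = (wcost w1 + wcost w2)%N.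
Proof. by rewrite /wcost /unzip2 map_cat lcost_cat. Qed.

Lemma wcost_zip (s : seq {set V}) xi : size s = size xi -> wcost (zip s xi) = lcost xi.
Proof. by move=> sz; rewrite /wcost unzip2_zip ?sz. Qed.

Lemma wsum_zip (s : seq {set V}) xi :
  size s = size xi -> wsum (zip s xi) = \sum_(x <- xi) x.
Proof. by move=> sz; rewrite /wsum -(big_map snd xpredT id) -/unzip2 unzip2_zip ?sz. Qed.

Lemma val_sum_Zp (I : Type) (r : seq I) (Q : pred I) (F : I -> Z) :
  (val (\sum_(i <- r | Q i) F i)%R <= \sum_(i <- r | Q i) val (F i))%N.
Proof.
apply: (big_ind2 (fun (x : Z) n => (val x <= n)%N)) => // x1 n1 x2 n2 le1 le2.
exact: leq_trans (val_addZp_le _ _) (leq_add le1 le2).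
Qed.

(** All labels on one edge of [s] are added up; a sum of residues never costs more than its
    terms. *)
Lemma word_gather E (s : seq {set V}) w : over (E :|: [set e in s]) w ->
  exists w1 xi, [/\ over E w1, size xi = size s,
    weight w =1 weight (w1 ++ zip s xi), wsum w = wsum (w1 ++ zip s xi) &
    (wcost w1 + lcost xi <= wcost w)%N].
Proof.
elim: s w => [|e s IHs] w w_E.
  exists w, [::]; rewrite cats0 lcost_nil addn0; split=> //.
  by apply: over_sub w_E => e; rewrite !inE orbF.
pose w0 := [seq a <- w | a.1 != e].
have [|w1 [xi [w1_E sz_xi bal_w1 sum_w1 cost_w1]]] := IHs w0.
  apply/allP => a; rewrite mem_filter => /andP[ne_ae /(allP w_E)].
  by rewrite !inE (negPf ne_ae).
exists w1, ((\sum_(a <- w | a.1 == e) a.2) :: xi); rewrite /= sz_xi; split=> //.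
- move=> z; rewrite weight_cat weight_cons addrCA -weight_cat -bal_w1.
  rewrite /weight (bigID (fun a => a.1 == e)) big_filter_cond /=; congr (_ + _).
    rewrite mulr_sumr big_mkcond [RHS]big_mkcond; apply: eq_bigr => a _.
    have [->|] := eqVneq a.1 e; rewrite ?andbF // andbT.
    by case: (z \in e); rewrite ?mul1r ?mul0r.
  by apply: eq_bigl => a; rewrite andbC.
- rewrite /wsum big_cat big_cons /= addrCA -big_cat -/(wsum (w1 ++ _)) -sum_w1.
  by rewrite /wsum (bigID (fun a => a.1 == e)) big_filter.
rewrite lcost_cons addnCA; apply: leq_trans (leq_add (leqnn _) cost_w1) _.
rewrite /wcost /lcost !big_map [leqRHS](bigID (fun a => a.1 == e)) big_filter.
by rewrite leq_add2r val_sum_Zp.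
Qed.

Lemma reaches_sub E w D c c' : (c <= c')%N -> reaches E w D c -> reaches E w D c'.
Proof. by move=> le_c [w' [? ? ?]]; exists w'; split=> //; apply: leq_trans le_c. Qed.

Lemma reaches_eq E w1 w2 D1 D2 c : weight w1 =1 weight w2 -> D1 =1 D2 ->
  reaches E w1 D1 c -> reaches E w2 D2 c.
Proof. by move=> eqw eqD [w' [? bal ?]]; exists w'; split=> // z; rewrite -eqw -eqD. Qed.

(** * Labels along a path *)

Section Path.
Implicit Types (u : V) (p : seq V).

Lemma size_path_edges u p : size (path_edges (u, p)) = size p.
Proof. exact: size_pairmap. Qed.

Lemma weight_path_cons u v p x xi z :
  weight (zip (path_edges (u, v :: p)) (x :: xi)) z
    = ((z == u) || (z == v))%:R * x + weight (zip (path_edges (v, p)) xi) z.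
Proof. by rewrite weight_cons !inE. Qed.

(** The change of weight under a unit alternating shift: consecutive signs cancel at the inner
    vertices and only the ends remain. *)
Definition bdry (p : V * seq V) z : Z :=
  (z == path_first p)%:R - (-1) ^+ path_length p * (z == path_last p)%:R.

Lemma weight_altshift u p xi t z : uniq (u :: p) -> size xi = size p ->
  weight (zip (path_edges (u, p)) (altshift xi t)) z
    = weight (zip (path_edges (u, p)) xi) z + t * bdry (u, p) z.
Proof.
rewrite /bdry /path_first /path_last /path_length /=.
elim: p u xi t => [|v p IHp] u [|x xi] t //=.
  by rewrite expr0 mul1r subrr mulr0 addr0.
rewrite inE negb_or -andbA => /and3P[ne_uv u_p /andP[v_p uniq_p]] [sz_xi].
rewrite !weight_path_cons IHp ?v_p // exprS.
have -> : ((z == u) || (z == v))%:R = (z == u)%:R + (z == v)%:R :> Z.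
  by have [->|] := eqVneq z u; rewrite ?(negPf ne_uv) ?addr0 ?add0r.
ring.
Qed.

Lemma path_edge_sub u p e z : e \in path_edges (u, p) -> z \in e -> z \in u :: p.
Proof.
elim: p u => //= v p IHp u; rewrite inE => /orP[/eqP->|/IHp z_e].
  by rewrite !inE => /orP[]->; rewrite ?orbT.
by move/z_e => z_vp; rewrite in_cons z_vp orbT.
Qed.

(** The shift is read off on the first edge; each inner weight then determines the label of the next
    edge. *)
Lemma altshift_of_weight u p xi xi' : uniq (u :: p) ->
    size xi = size p -> size xi' = size p ->
    {in behead (belast u p),
      weight (zip (path_edges (u, p)) xi') =1 weight (zip (path_edges (u, p)) xi)} ->
  exists t, xi' = altshift xi t.
Proof.
elim: p u xi xi' => [|v [|v' p] IHp] u [|x xi] [|x' xi'] //; first by exists 0.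
  by case: xi xi' => // -[] // _ _ _; exists (x' - x); rewrite /= addrC subrK.
set q := v' :: p in IHp *.
rewrite cons_uniq in_cons negb_or -andbA => /and3P[ne_uv u_q uniq_vq] [sz_xi] [sz_xi'] eq_w.
have /IHp[//|//|//|t def_xi'] : {in behead (belast v q),
    weight (zip (path_edges (v, q)) xi') =1 weight (zip (path_edges (v, q)) xi)}.
  move=> z z_in; have := eq_w z; rewrite inE z_in orbT => /(_ isT).
  rewrite !weight_path_cons.
  have z_q : z \in q by apply: mem_belast z_in.
  have /negPf-> : z != u by apply: contraNneq u_q => <-.
  have /negPf-> : z != v; last by rewrite !mul0r !add0r.
  by apply: contraTneq z_q => ->; case/andP: uniq_vq.
exists (x' - x); rewrite /= addrC subrK def_xi'; congr (_ :: altshift _ _).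
have := eq_w v; rewrite mem_head => /(_ isT).
rewrite !weight_path_cons def_xi' eqxx orbT !mul1r weight_altshift //.
rewrite /bdry /path_last /path_first /= eqxx.
have /negPf-> : v != last v' p.
  by case/andP: uniq_vq => v_q _; apply: contraNneq v_q => ->; apply: mem_last.
rewrite mulr0 subr0 mulr1 addrCA [x + _]addrC => /addrI <-; ring.
Qed.

End Path.

(** Weights at inner vertices involve only edges of the ear, so its labels are known up to a shift
    [t], whose effect on the remaining edges is [t * bdry p]. *)
Lemma reaches_ear E p w xi D c :
    uniq (p.1 :: p.2) -> {in path_inner p, forall z e, e \in E -> z \notin e} ->
    {in path_inner p, D =1 (fun=> 0)} -> over E w -> size xi = size p.2 ->
  reaches (E :|: [set e in path_edges p]) (w ++ zip (path_edges p) xi) D c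
  <-> exists t c', reaches E w (fun z => D z + t * bdry p z) c' /\
        (c' + lcost (altshift xi t) <= c)%N.
Proof.
case: p => u p /= uniq_p inner_E inner_D w_E sz_xi; split.
  case=> w' [w'_E bal_w' cost_w'].
  have [w1 [xi' [w1_E sz_xi' bal_w1 _ cost_w1]]] := word_gather w'_E.
  rewrite size_path_edges in sz_xi'.
  have [|t def_xi'] := altshift_of_weight uniq_p sz_xi sz_xi'.
    move=> z z_in; have {}z_in : z \in path_inner (u, p) by rewrite inE.
    have := bal_w' z; rewrite bal_w1 !weight_cat inner_D // addr0.
    have out v v_E := @weight_over_out E v z v_E (inner_E z z_in).
    by rewrite (out _ w_E) (out _ w1_E) !add0r.
  exists t, (wcost w1); split; last first.
    by rewrite -def_xi'; apply: leq_trans cost_w'.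
  exists w1; split=> // z; have := bal_w' z.
  rewrite bal_w1 !weight_cat def_xi' weight_altshift // => bal.
  by apply: (addIr (weight (zip (path_edges (u, p)) xi) z)); rewrite -bal; ring.
case=> t [c' [[w' [w'_E bal_w' cost_w']] le_c]].
exists (w' ++ zip (path_edges (u, p)) (altshift xi t)); split.
- rewrite over_cat; apply/andP; split.
    by apply: over_sub w'_E => e e_E; rewrite inE e_E.
  by apply: over_zip => e e_p; rewrite !inE e_p orbT.
- by move=> z; rewrite !weight_cat weight_altshift // -bal_w'; ring.
rewrite wcost_cat wcost_zip ?size_altshift ?size_path_edges //.
by apply: leq_trans le_c; rewrite leq_add2r.
Qed.

(** Words of equal weight differ on the ear by a shift [t], which changes the sum of labels by [t]
    in odd length and by 0 in even length. Hence the ear matters only through its ends and the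
    parity of its length. *)
Lemma graded_ear E p :
    uniq (p.1 :: p.2) -> {in path_inner p, forall z e, e \in E -> z \notin e} ->
  graded (E :|: [set e in path_edges p]) <->
  forall w w' t, over E w -> over E w' ->
    (forall z, weight w' z + t * bdry p z = weight w z) ->
    wsum w' + (odd (size p.2))%:R * t = wsum w.
Proof.
case: p => u p /= uniq_p inner_E; set pe := path_edges (u, p).
have over_p w xi : over E w -> over (E :|: [set e in pe]) (w ++ zip pe xi).
  move=> w_E; rewrite over_cat; apply/andP; split.
    by apply: over_sub w_E => e e_E; rewrite inE e_E.
  by apply: over_zip => e e_p; rewrite !inE e_p orbT.
split=> [grE w w' t w_E w'_E bal | grE w w' w_E w'_E bal].
  pose xi : seq Z := nseq (size p) 0.
  have sz_xi : size xi = size p by rewrite size_nseq.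
  have : wsum (w' ++ zip pe (altshift xi t)) = wsum (w ++ zip pe xi).
    apply: grE; [exact: over_p | exact: over_p | move=> z].
    by rewrite !weight_cat weight_altshift // -bal; ring.
  rewrite !wsum_cat !wsum_zip ?size_altshift ?size_path_edges // sum_altshift sz_xi.
  by move=> eq_s; apply: (addIr (\sum_(x <- xi) x)); rewrite -eq_s; ring.
have [w1 [xi [w1_E sz_xi bal1 -> _]]] := word_gather w_E.
have [w2 [xi' [w2_E sz_xi' bal2 -> _]]] := word_gather w'_E.
have {}bal z : weight (w1 ++ zip pe xi) z = weight (w2 ++ zip pe xi') z.
  by rewrite -bal1 -bal2.
rewrite !wsum_cat !wsum_zip //.
rewrite size_path_edges in sz_xi sz_xi'.
have [|t def_xi] := altshift_of_weight uniq_p sz_xi' sz_xi.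
  move=> z z_in; have {}z_in : z \in path_inner (u, p) by rewrite inE.
  have := bal z; rewrite !weight_cat.
  have out v v_E := @weight_over_out E v z v_E (inner_E z z_in).
  by rewrite (out _ w1_E) (out _ w2_E) !add0r.
rewrite def_xi sum_altshift sz_xi' -(grE w2 w1 t w2_E w1_E); first by ring.
move=> z; apply: (addIr (weight (zip pe xi') z)); rewrite -weight_cat -bal.
by rewrite weight_cat def_xi weight_altshift //; ring.
Qed.
End Words.

(** * Ears in graphs *)

Section Ears.
Variable V : finType.
Implicit Types (G : graph V) (p : V * seq V).

Lemma path_inner_split p x : x \in path_inner p ->
  exists (p1 : seq V) y (p2 : seq V), p.2 = p1 ++ x :: y :: p2.
Proof.
case: p => u [|y0 p] /=; rewrite inE //= => x_p.
move: (lastI y0 p) => ->; case/splitPr: x_p => p1 p2.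
rewrite rcons_cat /=; exists p1; case: p2 => [|y p2] /=; first by exists (last y0 p), [::].
by exists y, (rcons p2 (last y0 p)).
Qed.

Lemma open_ear_uniq G p : open_ear G p -> uniq (p.1 :: p.2).
Proof.
case=> -[/and5P[_ uniq_p uniq_b _ _] _]; case: p uniq_p uniq_b => u [|x p] //=.
rewrite /path_first /path_last => -> /= /andP[u_b _] ne_uv; rewrite andbT.
by rewrite (lastI x p) mem_rcons in_cons negb_or ne_uv.
Qed.

Lemma open_ear_sub G p : open_ear G p -> {subset path_edges p <= eset G}.
Proof. by case=> -[/and5P[_ _ _ _ /allP]]. Qed.

(** The path already has two distinct edges at [x], and [x] has degree two. *)
Lemma open_ear_inner G p x e : open_ear G p ->
  x \in path_inner p -> e \in eset G -> x \in e -> e \in path_edges p.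
Proof.
move=> ear_p x_p e_G x_e; have uniq_p := open_ear_uniq ear_p.
have [[_ /(_ x x_p) deg_x] _] := ear_p.
have [p1 [y [p2 def_p]]] := path_inner_split x_p.
have def_pe : path_edges p = path_edges (p.1, p1) ++
    [:: [set last p.1 p1; x], [set x; y] & path_edges (y, p2)].
  by rewrite /path_edges def_p pairmap_cat.
have pe_G := open_ear_sub ear_p.
set e1 := [set last p.1 p1; x] in def_pe; set e2 := [set x; y] in def_pe.
have pe1 : e1 \in path_edges p by rewrite def_pe mem_cat mem_head orbT.
have pe2 : e2 \in path_edges p by rewrite def_pe mem_cat !inE eqxx !orbT.
have ne12 : e1 != e2.
  apply: contraTneq uniq_p => eq12; rewrite def_p.
  have : y \in e1 by rewrite eq12 !inE eqxx orbT.
  rewrite !inE => /orP[/eqP y_last|/eqP->]; last first.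
    by rewrite -cat_cons cat_uniq /= mem_head !andbF.
  rewrite -cat_cons cat_uniq negb_and negb_and negbK; apply/orP; right; apply/orP; left.
  by apply/hasP; exists y; rewrite ?inE ?eqxx ?orbT // -in_cons y_last mem_last.
have : [set e1; e2] = [set f in eset G | x \in f].
  apply/eqP; rewrite eqEcard cards2 ne12 -/(degree G x) deg_x leqnn andbT.
  by apply/subsetP => f; rewrite !inE => /orP[]/eqP->; rewrite pe_G // !inE eqxx ?orbT.
by move/setP/(_ e); rewrite !inE e_G x_e => /orP[]/eqP->.
Qed.

Lemma open_ear_eset G p : open_ear G p ->
  eset G = eset (remove_ear G p) :|: [set e in path_edges p].
Proof.
move=> ear_p; apply/setP => e; rewrite !inE.
have [e_p|e_p] := boolP (e \in path_edges p).
  by rewrite orbT (open_ear_sub ear_p).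
rewrite orbF /remove_ear; case: ifP => _; rewrite !inE ?e_p //.
rewrite andb_idr // => e_G; apply/pred0P => x /=; apply/negbTE.
by apply: contra e_p => /andP[x_e x_p]; exact: (open_ear_inner ear_p x_p e_G x_e).
Qed.

Lemma remove_ear_inner G p :
  {in path_inner p, forall x e, e \in eset (remove_ear G p) -> x \notin e}.
Proof.
case: p => u p x x_p e; rewrite /remove_ear; case: ifP => [_|le1].
  by rewrite inE => /andP[_ /pred0P/(_ x)] /=; rewrite x_p andbT => ->.
by case: p x_p le1 => [|y [|z p]] //; rewrite inE.
Qed.

Lemma path_inner_ends p : uniq (p.1 :: p.2) -> [disjoint path_inner p & path_ends p].
Proof.
move=> uniq_p; apply/pred0P => x /=; apply/negbTE/negP => /andP[x_p].
have [p1 [y [p2 def_p]]] := path_inner_split x_p.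
move: uniq_p; rewrite /path_ends /path_first /path_last def_p !inE last_cat /=.
rewrite mem_cat !inE !negb_or => /andP[/and4P[_ ne_ux _ _]].
rewrite cat_uniq /= => /and4P[_ _]; rewrite inE negb_or => /andP[ne_xy x_p2] _.
rewrite eq_sym (negPf ne_ux) /= => /eqP x_last.
by move: (mem_last y p2); rewrite -x_last inE (negPf ne_xy) (negPf x_p2).
Qed.

Lemma path_color G p (c : V -> bool) :
    (forall x y, [set x; y] \in eset G -> c x != c y) ->
    {subset path_edges p <= eset G} ->
  c (path_last p) = c (path_first p) (+) odd (path_length p).
Proof.
move=> bip_c; rewrite /path_last /path_first /path_length; case: p => u p /=.
elim: p u => [|x p IHp] u sub_p /=; first by rewrite addbF.
rewrite IHp; last by move=> e e_p; apply: sub_p; rewrite in_cons e_p orbT.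
have := bip_c u x (sub_p _ (mem_head _ _)).
by case: (c u) (c x) (odd _) => -[] [].
Qed.

(** Each edge has exactly one end in a given colour class, so the sum of the labels is the sum of
    the weights over that class. *)
Lemma graded_bipartite k G : simple_graph G -> bipartite G -> graded k (eset G).
Proof.
move=> simpleG [c bip_c].
have wsumE w : over (eset G) w -> wsum w = \sum_(z | c z) weight (k := k) w z.
  move=> w_G; rewrite /weight (exchange_big_dep predT) //= /wsum big_seq [RHS]big_seq.
  apply: eq_bigr => a a_w; have e_G : a.1 \in eset G := allP w_G a a_w.
  have [_ /eqP/cards2P[x [y [ne_xy def_e]]]] := simpleG _ e_G.
  have := bip_c x y; rewrite -def_e => /(_ e_G) ne_c.
  wlog cx : x y ne_xy def_e ne_c / c x.
    move=> IH; case cx : (c x); first exact: (IH x y).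
    apply: (IH y x); rewrite 1?eq_sym //; first by rewrite setUC.
    by move: ne_c; rewrite cx; case: (c y).
  rewrite (big_pred1 x) // => z; rewrite def_e !inE /=.
  have [->|] := eqVneq z x; rewrite ?cx //=.
  by have [->|] := eqVneq z y; rewrite ?andbF //=; move: ne_c; rewrite cx; case: (c y).
by move=> w w' /wsumE-> /wsumE-> eq_w; apply: eq_bigr.
Qed.

End Ears.

(** * Images of words under a map of vertices *)

Section WordMap.
Variables (k : nat) (V W : finType) (f : V -> W).
Local Notation Z := 'Z_k.+2.
Implicit Types (E : {set {set V}}) (w : seq ({set V} * Z)).

Definition wmap w := [seq (f @: (a.1 : {set V}), a.2) | a <- w].

Definition emap E := [set f @: (e : {set V}) | e in E].

Lemma over_wmap E w : over E w -> over (emap E) (wmap w).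
Proof. by move/allP=> w_E; apply/allP => _ /mapP[a a_w ->]; apply/imset_f/w_E. Qed.

Lemma over_emap E (y : seq ({set W} * Z)) :
  over (emap E) y -> exists2 w, over E w & y = wmap w.
Proof.
elim: y => [|[e' x] y IHy] /=; first by exists [::].
case/andP=> /imsetP[e e_E ->] /IHy[w w_E ->].
by exists ((e, x) :: w) => //=; rewrite e_E.
Qed.

Lemma wcost_wmap w : wcost (wmap w) = wcost w.
Proof. by rewrite /wcost /unzip2 -map_comp. Qed.

Lemma wsum_wmap w : wsum (wmap w) = wsum w.
Proof. by rewrite /wsum big_map. Qed.

Lemma weight_wmap w z :
  weight (wmap w) z = \sum_(a <- w | z \in f @: (a.1 : {set V})) a.2.
Proof. by rewrite /weight big_map. Qed.
End WordMap.

(** * Two ears with common end-vertices *)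

Section TwoEars.
Variables (k : nat) (V : finType).
Local Notation Z := 'Z_k.+2.
Implicit Types (E : {set {set V}}) (p : V * seq V) (w : seq ({set V} * Z)).

Lemma bdry_inner p x : uniq (p.1 :: p.2) -> x \in path_inner p -> bdry k p x = 0.
Proof.
move=> /path_inner_ends dis_p x_p; have := pred0P dis_p x.
rewrite /= x_p !inE => /negbT; rewrite negb_or => /andP[/negPf x1 /negPf x2].
by rewrite /bdry x1 x2 mulr0 subr0.
Qed.

Lemma bdry_same_ends p p' : uniq (p.1 :: p.2) ->
    path_first p != path_last p -> path_ends p = path_ends p' ->
    odd (path_length p) = odd (path_length p') ->
  bdry k p' =1 bdry k p
  \/ (forall z, bdry k p' z = - (-1) ^+ path_length p' * bdry k p z).
Proof.
rewrite /bdry /path_ends; move: (path_first p) (path_last p) => u v _ ne_uv.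
move: (path_first p') (path_last p') => u' v' eq_ends eq_odd.
have : u \in [set u'; v'] by rewrite -eq_ends !inE eqxx.
have : v \in [set u'; v'] by rewrite -eq_ends !inE eqxx orbT.
have -> : (-1) ^+ path_length p = (-1) ^+ path_length p' :> Z.
  by rewrite -signr_odd eq_odd signr_odd.
have ss : (-1) ^+ path_length p' * (-1) ^+ path_length p' = 1 :> Z.
  by rewrite -expr2 sqrr_sign.
rewrite !inE => /orP[]/eqP v_def /orP[]/eqP u_def; move: ne_uv; rewrite u_def v_def ?eqxx //.
  by right=> z; rewrite mulrBr !mulNr mulrA ss; ring.
by left.
Qed.

Definition orient b (l : seq Z) := if b then rev l else l.

Lemma orientK b : involutive (orient b).
Proof. by case: b => l //=; rewrite revK. Qed.

Lemma size_orient b l : size (orient b l) = size l.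
Proof. by case: b; rewrite /= ?size_rev. Qed.

(** The ears may run in opposite directions. Reading the labels of [p'] in the direction of [p] lets
    both shifts act through the same [bdry k p]. *)
Lemma reaches_ear_along p p' : uniq (p.1 :: p.2) -> uniq (p'.1 :: p'.2) ->
    path_first p != path_last p -> path_ends p = path_ends p' ->
    odd (path_length p) = odd (path_length p') ->
  exists b, forall E w zeta D c,
    {in path_inner p', forall z e, e \in E -> z \notin e} ->
    {in path_inner p', D =1 (fun=> 0)} -> over E w -> size zeta = size p'.2 ->
  reaches (E :|: [set e in path_edges p']) (w ++ zip (path_edges p') (orient b zeta)) D c
  <-> exists t c', reaches E w (fun z => D z + t * bdry k p z) c' /\
        (c' + lcost (altshift zeta t) <= c)%N.
Proof.
move=> uniq_p uniq_p' ne_uv same_ends eq_odd.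
have [bE|bE] := bdry_same_ends uniq_p ne_uv same_ends eq_odd.
  exists false => E w zeta D c inner_E inner_D w_E sz.
  apply: (iff_trans (reaches_ear _ uniq_p' inner_E inner_D w_E sz)).
  by split=> -[t [c' [red le_c]]]; exists t, c'; split=> //;
     apply: reaches_eq red => // z; rewrite bE.
exists true => E w zeta D c inner_E inner_D w_E sz.
pose s : Z := - (-1) ^+ path_length p'.
have ss : s * s = 1 by rewrite mulrNN -expr2 sqrr_sign.
have sz' : size (rev zeta) = size p'.2 by rewrite size_rev.
apply: (iff_trans (reaches_ear _ uniq_p' inner_E inner_D w_E sz')).
split=> -[t [c' [red le_c]]]; exists (s * t), c'; split.
- by apply: reaches_eq red => // z; rewrite bE -/s; congr (_ + _); ring.
- by move: le_c; rewrite altshift_rev lcost_rev sz -/s.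
- apply: reaches_eq red => // z; rewrite bE -/s; congr (_ + _).
  by rewrite -[t in LHS]mul1r -ss; ring.
by rewrite altshift_rev lcost_rev sz -/(path_length p') -/s mulrA ss mul1r.
Qed.

(** The ears are eliminated in turn: a shift of [p'] acts on the rest by a multiple of [bdry k p],
    which vanishes at the inner vertices of [p]. *)
Lemma reduces_two_ears E p p' B : uniq (p.1 :: p.2) -> uniq (p'.1 :: p'.2) ->
    path_first p != path_last p -> path_ends p = path_ends p' ->
    odd (path_length p) = odd (path_length p') ->
    {in path_inner p, forall z e, e \in E -> z \notin e} ->
    {in path_inner p', forall z e,
      e \in E :|: [set e in path_edges p] -> z \notin e} ->
  reduces k (E :|: [set e in path_edges p] :|: [set e in path_edges p']) B <->
  forall w xi zeta, over E w -> size xi = size p.2 -> size zeta = size p'.2 ->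
  exists t t' c, reaches E w (fun z => (t + t') * bdry k p z) c /\
    (c + lcost (altshift xi t) + lcost (altshift zeta t') <= B)%N.
Proof.
move=> uniq_p uniq_p' ne_uv same_ends eq_odd inner_E inner_E'.
have [b earP] := reaches_ear_along uniq_p uniq_p' ne_uv same_ends eq_odd.
set E1 := E :|: _ in inner_E' *.
have over1 w xi : over E w -> over E1 (w ++ zip (path_edges p) xi).
  move=> w_E; rewrite over_cat; apply/andP; split.
    by apply: over_sub w_E => e e_E; rewrite inE e_E.
  by apply: over_zip => e e_p; rewrite !inE e_p orbT.
have earE w xi t c : over E w -> size xi = size p.2 ->
    reaches E1 (w ++ zip (path_edges p) xi) (fun z => 0 + t * bdry k p z) c <->
    exists s c', reaches E w (fun z => 0 + t * bdry k p z + s * bdry k p z) c' /\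
        (c' + lcost (altshift xi s) <= c)%N.
  move=> w_E sz; apply: reaches_ear => // z z_p.
  by rewrite bdry_inner // mulr0 addr0.
split=> red.
  move=> w xi zeta w_E sz_xi sz_zeta.
  have D0 : {in path_inner p', (fun=> 0 : Z) =1 (fun=> 0)} by [].
  have [|t' [c1 [red1 le1]]] := (earP E1 _ zeta _ B inner_E' D0 (over1 _ xi w_E) sz_zeta).1 _.
    apply: red; rewrite over_cat; apply/andP; split.
      by apply: over_sub (over1 _ xi w_E) => e e_E; rewrite inE e_E.
    by apply: over_zip => e e_p; rewrite !inE e_p !orbT.
  have [t [c [red2 le2]]] := (earE _ _ _ _ w_E sz_xi).1 red1.
  exists t, t', c; split; first by apply: reaches_eq red2 => // z; ring.
  by apply: leq_trans le1; rewrite leq_add2r.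
move=> w0 w0_E.
have [w1 [zeta [w1_E sz_zeta eq1 _ _]]] := word_gather w0_E.
have [w [xi [w_E sz_xi eq2 _ _]]] := word_gather w1_E.
move: sz_zeta sz_xi; rewrite (surjective_pairing p) (surjective_pairing p') !size_path_edges
  -!surjective_pairing => sz_zeta sz_xi.
have [t [t' [c [red1 le1]]]] := red w xi (orient b zeta) w_E sz_xi
  (etrans (size_orient _ _) sz_zeta).
apply: (@reaches_eq _ _ _ (w ++ zip (path_edges p) xi ++ zip (path_edges p') zeta)
   _ (fun=> 0)) => // [z|].
  by rewrite eq1 catA !weight_cat -weight_cat -eq2.
rewrite catA -[zeta](orientK b); apply/earP; rewrite ?size_orient //; first exact: over1.
exists t', (c + lcost (altshift xi t))%N; split=> //.
apply/earE => //; exists t, c; split=> //.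
by apply: reaches_eq red1 => // z; ring.
Qed.
End TwoEars.

(** * Ear modifications *)

Section Modifications.
Variables (k : nat) (V : finType).
Local Notation Z := 'Z_k.+2.
Implicit Types (E : {set {set V}}) (p : V * seq V) (w : seq ({set V} * Z)).

Definition replaced_edges E p m : {set {set (V + 'I_m)}} :=
  emap inl E :|: [set e in path_edges (new_path p m)].

(** * Replacing an ear by a new path *)

Section Replace.
Variables (E : {set {set V}}) (p : V * seq V) (m : nat).
Hypotheses (ne_ends : path_first p != path_last p)
  (odd_m : odd m.+1 = odd (path_length p)).
Let q := new_path p m.

Let size_q : size q.2 = m.+1.
Proof. by rewrite size_rcons size_map size_enum_ord. Qed.

Let uniq_q : uniq (q.1 :: q.2).
Proof.
rewrite cons_uniq rcons_uniq mem_rcons in_cons negb_or.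
rewrite (inj_eq (@inl_inj _ _)) ne_ends map_inj_uniq ?enum_uniq => [|i j [] //].
by rewrite andbT; apply/andP; split; apply/mapP => -[].
Qed.

Let inner_q : {in path_inner q, forall z e, e \in emap inl E -> z \notin e}.
Proof.
move=> z; rewrite inE => z_q _ /imsetP[e _ ->]; apply/imsetP => -[x _ z_x].
move: z_q; rewrite z_x /q /new_path /=.
case: (enum 'I_m) => //= i l; rewrite belast_rcons in_cons /=.
by elim: l.
Qed.

(** Equal parity of the lengths is what makes the two boundaries agree. *)
Let bdry_q z : bdry k q z = if z is inl x then bdry k p x else 0.
Proof.
rewrite /bdry /path_length size_q -signr_odd odd_m signr_odd /path_last last_rcons.
by case: z => [x|i]; rewrite /path_first //= mulr0 subr0.
Qed.

Let weight_inl w (x : V) : weight (wmap (inl : V -> V + 'I_m) w) (inl x) = weight w x.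
Proof. by rewrite weight_wmap; apply: eq_bigl => a; rewrite mem_imset //; apply: inl_inj. Qed.

Let weight_inr w (i : 'I_m) : weight (wmap (inl : V -> V + 'I_m) w) (inr i) = 0.
Proof.
rewrite weight_wmap big_pred0 // => a; apply/negbTE/imsetP => -[] //.
Qed.

Lemma reduces_replaced B : reduces k (replaced_edges E p m) B <->
  forall w chi, over E w -> size chi = m.+1 ->
  exists t c, reaches E w (fun z => t * bdry k p z) c /\
    (c + lcost (altshift chi t) <= B)%N.
Proof.
have D0 : {in path_inner q, (fun=> 0 : Z) =1 (fun=> 0)} by [].
split=> red.
  move=> w chi w_E sz_chi; have sz_q := etrans sz_chi (esym size_q).
  have [|t [c [[_ [/over_emap[w' w'_E ->] bal cost_w']] le_c]]] :=
      (reaches_ear B uniq_q inner_q D0 (over_wmap inl w_E) sz_q).1 _.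
    apply: red; rewrite over_cat; apply/andP; split.
      by apply: over_sub (over_wmap inl w_E) => e e_E; rewrite inE e_E.
    by apply: over_zip => e e_p; rewrite !inE e_p !orbT.
  exists t, c; split=> //; exists w'; split=> //; last by rewrite wcost_wmap in cost_w'.
  by move=> z; have := bal (inl z); rewrite !weight_inl add0r bdry_q.
move=> y y_E; have [y1 [chi [y1_E sz_chi eq_y _ _]]] := word_gather y_E.
have [w w_E def_y1] := over_emap y1_E.
rewrite size_path_edges size_q in sz_chi.
have [t [c [[w' [w'_E bal cost_w']] le_c]]] := red w chi w_E sz_chi.
apply: (@reaches_eq _ _ _ (y1 ++ zip (path_edges q) chi) _ (fun=> 0)) => //.
apply/(reaches_ear B uniq_q inner_q D0 y1_E (etrans sz_chi (esym size_q))).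
exists t, c; split=> //; exists (wmap inl w'); split; first exact: over_wmap.
  move=> [x|i]; rewrite def_y1 add0r bdry_q; first by rewrite !weight_inl bal.
  by rewrite !weight_inr mulr0 addr0.
by rewrite wcost_wmap.
Qed.

Lemma graded_replaced : uniq (p.1 :: p.2) ->
    {in path_inner p, forall z e, e \in E -> z \notin e} ->
  graded k (E :|: [set e in path_edges p]) -> graded k (replaced_edges E p m).
Proof.
move=> uniq_p inner_E /(graded_ear k uniq_p inner_E) grE.
apply/(graded_ear k uniq_q inner_q) => y y' t /over_emap[w w_E ->] /over_emap[w' w'_E ->] bal.
rewrite !wsum_wmap size_q odd_m; apply: grE => // z.
by have := bal (inl z); rewrite !weight_inl bdry_q.
Qed.

End Replace.

(** * Identifying the end-vertices of an even ear *)

Section Identify.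
Variables (E : {set {set V}}) (p : V * seq V).
Let u := path_first p.
Let v := path_last p.
Hypotheses (ne_uv : u != v) (even_p : ~~ odd (path_length p))
  (uv_E : forall e, e \in E -> ~~ ((u \in e) && (v \in e))).
Let f x := if x == v then u else x.

(** An edge containing both [u] and [v] would count once in the image but twice in the sum of
    weights; [uv_E] excludes it. *)
Let weight_f w z : over E w -> weight (wmap f w) z =
  if z == v then 0 else if z == u then weight w u + weight w v else weight w z.
Proof.
move=> w_E; rewrite weight_wmap.
have fE (e : {set V}) : (z \in f @: e) =
    if z == v then false else if z == u then (u \in e) || (v \in e) else z \in e.
  apply/imsetP/idP=> [[x x_e ->]|].
    rewrite /f; have [x_v|ne_xv] := eqVneq x v.
      by rewrite (negPf ne_uv) eqxx -x_v x_e orbT.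
    by rewrite (negPf ne_xv); case: eqP x_e => [->|_] ->.
  case: eqVneq => // ne_zv; case: eqVneq => [->|ne_zu].
    case/orP=> [u_e|v_e]; [exists u | exists v] => //; rewrite /f ?eqxx //.
    by rewrite (negPf ne_uv).
  by exists z => //; rewrite /f (negPf ne_zv).
case: eqVneq => [z_v|ne_zv].
  by rewrite big_pred0 // => a; rewrite fE z_v eqxx.
case: eqVneq => [z_u|ne_zu]; last first.
  by apply: eq_bigl => a; rewrite fE (negPf ne_zv) (negPf ne_zu).
rewrite /weight big_mkcond [in RHS]big_mkcond [X in _ = _ + X]big_mkcond -big_split /=.
rewrite big_seq [RHS]big_seq; apply: eq_bigr => a a_w.
rewrite fE (negPf ne_zv) z_u eqxx; have := uv_E (allP w_E a a_w).
by case: (u \in _) (v \in _) => -[]; rewrite ?addr0 ?add0r.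
Qed.

Let bdry_uv z : bdry k p z = (z == u)%:R - (z == v)%:R.
Proof. by rewrite /bdry -signr_odd (negPf even_p) mul1r. Qed.

(** Identification forgets only how weight is distributed between [u] and [v], and a shift of an
    even ear moves weight from one to the other. *)
Let weight_f_eq w w' : over E w -> over E w' ->
  weight (wmap f w') =1 weight (wmap f w) <->
  exists t, forall z, weight w' z + t * bdry k p z = weight w z.
Proof.
move=> w_E w'_E; split=> [eq_w | [t bal] z].
  exists (weight w u - weight w' u) => z; rewrite bdry_uv.
  have := eq_w z; rewrite !weight_f //; case: eqVneq => [-> _|ne_zv].
    have := eq_w u; rewrite !weight_f // (negPf ne_uv) eqxx eq_sym (negPf ne_uv).
    by rewrite sub0r mulrN1 opprB => e; apply: (addrI (weight w u)); rewrite -e; ring.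
  by case: eqVneq => [->|_ ->]; last ring; move=> _; rewrite /=; ring.
rewrite !weight_f // -!bal !bdry_uv eqxx [v == u]eq_sym (negPf ne_uv) eqxx.
by case: eqVneq => // ne_zv; case: eqVneq => // _; ring.
Qed.

Lemma reduces_identified B :
    (forall w, over E w -> exists t, reaches E w (fun z => t * bdry k p z) B) ->
  reduces k (emap f E) B.
Proof.
move=> red y /over_emap[w w_E ->]; have [t [w' [w'_E bal cost_w']]] := red w w_E.
exists (wmap f w'); split; [exact: over_wmap | | by rewrite wcost_wmap].
by move=> z; rewrite addr0; apply: (weight_f_eq w_E w'_E).2; exists t.
Qed.

Lemma graded_identified : uniq (p.1 :: p.2) ->
    {in path_inner p, forall z e, e \in E -> z \notin e} ->
  graded k (E :|: [set e in path_edges p]) -> graded k (emap f E).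
Proof.
move=> uniq_p inner_E /(graded_ear k uniq_p inner_E) grE.
move=> y y' /over_emap[w w_E ->] /over_emap[w' w'_E ->] eq_w.
rewrite !wsum_wmap; have [|t bal] := (weight_f_eq w_E w'_E).1 _; first by move=> z.
by rewrite -(grE w w' t) // -/(path_length p) (negPf even_p) mul0r addr0.
Qed.
End Identify.

End Modifications.

(** * A pair of ears compared with one modified ear *)

Section Comparison.
Variables (k : nat) (V : finType) (E : {set {set V}}) (p p' : V * seq V).
Local Notation Z := 'Z_k.+2.
Hypotheses (uniq_p : uniq (p.1 :: p.2)) (uniq_p' : uniq (p'.1 :: p'.2))
  (ne_ends : path_first p != path_last p) (same_ends : path_ends p = path_ends p')
  (eq_odd : odd (path_length p) = odd (path_length p'))
  (inner_E : {in path_inner p, forall z e, e \in E -> z \notin e})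
  (inner_E' : {in path_inner p', forall z e,
      e \in E :|: [set e in path_edges p] -> z \notin e}).
Let EG := E :|: [set e in path_edges p] :|: [set e in path_edges p'].

Let odd_merged a : odd (path_length p + a.*2).-1.+1 = odd (path_length p).
Proof.
have p_gt0 : (0 < path_length p)%N.
  by move: ne_ends; rewrite /path_first /path_last /path_length; case: p.2; rewrite ?eqxx.
by rewrite prednK ?addn_gt0 ?p_gt0 // oddD odd_double addbF.
Qed.

Let two_ears B := reduces_two_ears k B uniq_p uniq_p' ne_ends same_ends eq_odd
  inner_E inner_E'.

(** The merged list of two labellings is a labelling of the longer ear, and a shift within the bound
    there splits into shifts of the two ears within the same bound. *)
Lemma reduces_merge B :
  reduces k (replaced_edges E p (path_length p + (path_length p')./2.*2).-1) B ->
  reduces k EG B.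
Proof.
move/(reduces_replaced k _ ne_ends (odd_merged _)) => red.
apply/two_ears => w xi zeta w_E sz_xi sz_zeta.
have [|chi sz_chi le_chi] := @lcost_altshift_merge k xi zeta; first by rewrite sz_xi sz_zeta.
have [|s [c [red_s le_B]]] := red w chi w_E.
  rewrite sz_chi sz_xi sz_zeta -/(path_length p) -/(path_length p').
  rewrite prednK // addn_gt0; move: ne_ends.
  by rewrite /path_first /path_last /path_length; case: p.2; rewrite ?eqxx.
have [t [t' [def_s le_s]]] := le_chi s.
exists t, t', c; rewrite def_s; split=> //; apply: leq_trans le_B.
by rewrite -addnA leq_add2l.
Qed.

(** The labels 0, -1, 0, -1, ... on both ears cost at least [d] at all shifts. This leaves [B - d]
    for the other edges, with a free multiple of [bdry k p]. *)
Lemma reduces_even B : ~~ odd (path_length p) -> reduces k EG B ->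
  let d := (((path_length p)./2 + (path_length p')./2) * k.+1)%N in
  (d <= B)%N /\
  forall w, over E w -> exists t, reaches E w (fun z => t * bdry k p z) (B - d).
Proof.
move=> even_p /two_ears red d.
pose l n : seq Z := flatten (nseq n [:: 0; -1]).
have {}red w : over E w -> exists t c,
    reaches E w (fun z => t * bdry k p z) c /\ (c + d <= B)%N.
  move=> w_E; have [||t [t' [c [red_c le_c]]]] :=
    red w (l (path_length p)./2) (l (path_length p')./2) w_E.
  - by rewrite size_pairs even_halfK.
  - by rewrite size_pairs even_halfK // -eq_odd.
  exists (t + t'), c; split=> //; apply: leq_trans le_c.
  by rewrite -addnA leq_add2l /d mulnDl leq_add ?lcost_altshift_pairs.
split=> [|w /red[t [c [red_c le_c]]]].
  by have [//|t [c [_ le_c]]] := red [::]; apply: leq_trans le_c; apply: leq_addl.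
by exists t; apply: reaches_sub red_c; rewrite leq_subRL ?(leq_trans (leq_addl _ _) le_c) // addnC.
Qed.

Lemma reduces_odd B : odd (path_length p) -> reduces k EG B ->
  let d := (((path_length p)./2 + (path_length p')./2) * k.+1)%N in
  (d <= B)%N /\ reduces k (replaced_edges E p 0) (B - d).
Proof.
move=> odd_p red d.
(* The last label is [x] on [p] and 0 on [p']. Residues being subadditive, [x + t] and [t'] cost at
   least as much as [x + (t + t')], the label of a one-edge ear shifted by [t + t']. *)
pose l n (x : Z) : seq Z := flatten (nseq n [:: 0; -1]) ++ [:: x].
have le_l n (x t : Z) : (n * k.+1 + val (x + t)%R <= lcost (altshift (l n x) t))%N.
  rewrite altshift_cat lcost_cat leq_add ?lcost_altshift_pairs //= lcost_cons lcost_nil.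
  by rewrite size_pairs -signr_odd odd_double mul1r addn0.
have sz_l n x : size (l n x) = n.*2.+1 by rewrite size_cat size_pairs addn1.
have {}red w x : over E w -> exists t c, reaches E w (fun z => t * bdry k p z) c /\
    (c + val (x + t)%R + d <= B)%N.
  move=> w_E; have [||t [t' [c [red_c le_c]]]] :=
    (two_ears _).1 red w (l (path_length p)./2 x) (l (path_length p')./2 0) w_E.
  - by rewrite sz_l -[RHS]odd_double_half -/(path_length p) odd_p.
  - by rewrite sz_l -[RHS]odd_double_half -/(path_length p') -eq_odd odd_p.
  exists (t + t'), c; split=> //; apply: leq_trans le_c.
  have := le_l (path_length p)./2 x t; have := le_l (path_length p')./2 0 t'.
  have := val_addZp_le (x + t) t'; rewrite add0r -addrA /d mulnDl.
  by move: (lcost _) (lcost _) (val _) (val _) (val _) => *; lia.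
have le_d : (d <= B)%N.
  by have [//|t [c [_ le_c]]] := red [::] 0; apply: leq_trans le_c; apply: leq_addl.
split=> //; apply/reduces_replaced => // w [|x []] // w_E _.
have [t [c [red_c le_c]]] := red w x w_E.
exists t, c; split=> //=; rewrite lcost_cons lcost_nil addn0.
by rewrite leq_subRL // addnC.
Qed.

End Comparison.

(** With no other edge, the weight at an end-vertex forces the shift to be 0, so constant labels
    [-1] have the maximal cost. *)
Lemma reduces_replaced_set0 k (V : finType) (p : V * seq V) m B :
    path_first p != path_last p -> odd m.+1 = odd (path_length p) ->
  reduces k (replaced_edges set0 p m) B <-> (m.+1 * k.+1 <= B)%N.
Proof.
move=> ne_ends odd_m.
have over0 (w : seq ({set V} * 'Z_k.+2)) : over set0 w -> w = [::].
  by case: w => //= a w; rewrite inE.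
split=> [/(reduces_replaced k _ ne_ends odd_m) red | le_B].
  have [|t [c [[w' [/over0-> bal _]] le_B]]] := red [::] (nseq m.+1 (-1)) isT.
    by rewrite size_nseq.
  have := bal (path_first p); rewrite /bdry eqxx (negPf ne_ends) mulr0 subr0 mulr1.
  rewrite !weight_nil add0r => t0; rewrite t0 altshift0 in le_B.
  have -> : (m.+1 * k.+1 = lcost (nseq m.+1 (-1 : 'Z_k.+2)%R))%N.
    elim: m.+1 => [|n IHn]; first by rewrite lcost_nil.
    rewrite mulSn /= lcost_cons IHn; congr addn.
    by apply/eqP; rewrite eqn_leq val_Zp_le andbT; have := val_addZpN1 (0 : 'Z_k.+2); rewrite subr0.
  by apply: leq_trans le_B; apply: leq_addl.
apply/reduces_replaced => // w chi /over0-> sz_chi; exists 0, 0%N; split.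
  exists [::]; split=> // [z|]; first by rewrite weight_nil mul0r addr0.
  by rewrite /wcost lcost_nil.
by rewrite altshift0 add0n; apply: leq_trans (lcost_le _) _; rewrite sz_chi.
Qed.

(** * Koszul homology and regularity *)

Section QuotientDimension.

Lemma bool_pred (P : nat -> Prop) : exists p : pred nat, forall m, P m <-> p m.
Proof.
exists (fun m => if excluded_middle_informative (P m) then true else false) => m.
by case: excluded_middle_informative.
Qed.

Lemma ex_max_nat (P : nat -> Prop) b :
  (exists m, P m) -> (forall m, P m -> (m <= b)%N) ->
  exists2 m, P m & forall m', P m' -> (m' <= m)%N.
Proof.
have [p pP] := bool_pred P => -[m0 /pP p_m0] leP.
have lep m : p m -> (m <= b)%N by move/pP/leP.
by case: (ex_maxnP (ex_intro _ m0 p_m0) lep) => m /pP Pm max_m; exists m => // m' /pP/max_m.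
Qed.

Lemma ex_min_nat (P : nat -> Prop) :
  (exists m, P m) -> exists2 m, P m & forall m', P m' -> (m <= m')%N.
Proof.
have [p pP] := bool_pred P => -[m0 /pP p_m0].
by case: (ex_minnP (ex_intro _ m0 p_m0)) => m /pP Pm min_m; exists m => // m' /pP/min_m.
Qed.

Variables (F : finFieldType) (U : lmodType F) (Z B : U -> Prop).
Hypotheses (Z_lin : forall a x y, Z x -> Z y -> Z (a *: x + y))
  (B_lin : forall a x y, B x -> B y -> B (a *: x + y)) (B0 : B 0).

Let B_sum m (a : 'I_m -> F) (x : 'I_m -> U) :
  (forall i, B (x i)) -> B (\sum_i a i *: x i).
Proof.
move=> Bx; elim/big_ind: _ => // [u v Bu Bv | i _].
  by rewrite -[u]scale1r; apply: B_lin.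
by rewrite -[_ *: _]addr0; apply: B_lin.
Qed.

Let B_opp x : B x -> B (- x).
Proof. by move=> Bx; rewrite -scaleN1r -[_ *: _]addr0; apply: B_lin. Qed.

(** The finite target of [phi] bounds families independent modulo [B], and a family of maximal size
    spans. This makes the [epsilon] in [betti] an actual dimension. *)
Lemma quotient_dim_exists (T : finType) (phi : U -> T) :
    (forall x y, Z x -> Z y -> phi x = phi y -> x = y) -> Z 0 ->
  exists m, is_quotient_dim Z B m.
Proof.
move=> phi_inj Z0.
have Z_sum m (a : 'I_m -> F) (x : 'I_m -> U) :
    (forall i, Z (x i)) -> Z (\sum_i a i *: x i).
  move=> Zx; elim/big_ind: _ => // [u v Zu Zv | i _].
    by rewrite -[u]scale1r; apply: Z_lin.
  by rewrite -[_ *: _]addr0; apply: Z_lin.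
pose indep m := exists x : 'I_m -> U, (forall i, Z (x i)) /\
  forall a : {ffun 'I_m -> F}, B (\sum_i a i *: x i) -> a = [ffun=> 0].
have [| | m [x [Zx indep_x]] max_m] := @ex_max_nat indep #|T|.
- by exists 0%N, (fun=> 0); split=> // a _; apply/ffunP => -[].
- move=> m [x [Zx indep_x]].
  have /leq_card : injective (fun a : {ffun 'I_m -> F} => phi (\sum_i a i *: x i)).
    move=> a a' /phi_inj eq_s; apply/ffunP => i; apply/eqP; rewrite -subr_eq0.
    have /indep_x/ffunP/(_ i) : B (\sum_i [ffun i => a i - a' i] i *: x i).
      under eq_bigr do rewrite ffunE scalerBl.
      by rewrite sumrB eq_s ?subrr //; apply: Z_sum.
    by rewrite !ffunE => ->.
  rewrite card_ffun card_ord => le_T; apply: leq_trans le_T.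
  by apply: ltnW; apply: ltn_expl; apply: card_finNzRing_gt1.
exists m, x; split=> // z Zz.
have [a Ba] : exists a : {ffun 'I_m -> F}, B (z - \sum_i a i *: x i).
  apply: NNPP => no_a.
  suff /max_m : indep m.+1 by rewrite ltnn.
  (* Adjoining [z] keeps independence: a relation with coefficient 0 at [z] is one among the [x j],
     and any other could be solved for [z]. *)
  pose y (i : 'I_m.+1) := if unlift ord_max i is Some j then x j else z.
  exists y; split=> [i|b].
    by rewrite /y; case: unlift.
  have lift_y j : y (widen_ord (leqnSn m) j) = x j.
    have -> : widen_ord (leqnSn m) j = lift ord_max j.
      by apply: val_inj; rewrite [RHS]lift_max.
    by rewrite /y liftK.
  rewrite big_ord_recr /= {2}/y unlift_none.
  under eq_bigr do rewrite lift_y.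
  move=> Bb; have [b0|nz_b] := eqVneq (b ord_max) 0.
    pose b' : {ffun 'I_m -> F} := [ffun j => b (widen_ord (leqnSn m) j)].
    have /indep_x/ffunP b'0 : B (\sum_i b' i *: x i).
      by move: Bb; rewrite b0 scale0r addr0; under [X in _ -> B X]eq_bigr do rewrite ffunE.
    apply/ffunP => i; rewrite ffunE; have [j ->|->] := unliftP ord_max i; last exact: b0.
    have := b'0 j; rewrite !ffunE => <-; congr (b _); apply: val_inj; exact: lift_max.
  case: no_a; exists [ffun i => - (b ord_max)^-1 * b (widen_ord (leqnSn m) i)].
  rewrite -sumrN; under eq_bigr do rewrite ffunE mulNr scaleNr opprK -scalerA.
  rewrite -scaler_sumr -[z in z + _]scale1r -(mulVf nz_b) -scalerA -scalerDr addrC.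
  by rewrite -[_ *: _]addr0; apply: B_lin.
exists a; split=> // a' Ba'; apply/ffunP => i; apply/eqP; rewrite -subr_eq0.
have /indep_x/ffunP/(_ i) : B (\sum_i [ffun i => a i - a' i] i *: x i).
  under eq_bigr do rewrite ffunE scalerBl.
  rewrite sumrB.
  have -> : \sum_i a i *: x i - \sum_i a' i *: x i =
      (-1) *: (z - \sum_i a i *: x i) + (z - \sum_i a' i *: x i).
    by rewrite scaleN1r opprB addrA subrK.
  exact: B_lin.
by rewrite !ffunE => ->.
Qed.

Lemma quotient_dim_eq0 m : is_quotient_dim Z B m -> Z 0 ->
  (forall x, Z x -> B x) -> m = 0%N.
Proof.
case=> x [Zx dim_x] Z0 sZB; have [a [_ uniq_a]] := dim_x 0 Z0.
have Ba (c : F) : a = [ffun=> c].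
  by apply: uniq_a; rewrite add0r; apply/B_opp/B_sum => i; apply/sZB.
case: m x Zx dim_x a uniq_a Ba => // m x _ _ a _ Ba.
by have /ffunP/(_ ord0)/eqP := etrans (esym (Ba 1)) (Ba 0); rewrite !ffunE oner_eq0.
Qed.

End QuotientDimension.

(** * Koszul chains and their differential *)

Section Koszul.
Variables (F : finFieldType) (n : nat).
Local Notation S := {mpoly F[n]}.
Local Notation koszul := {ffun {set 'I_n} -> S}.
Implicit Types (c b : koszul) (s : {set 'I_n}) (x : 'I_n -> F).

Lemma koszul_chain_lin i j a c b :
  koszul_chain i j c -> koszul_chain i j b -> koszul_chain i j (a *: c + b).
Proof.
move=> cc cb s; rewrite !ffunE => nz.
have homog_c : c s \is (j - i).-homog.
  by have [->|/cc[]//] := eqVneq (c s) 0; apply: rpred0.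
have homog_b : b s \is (j - i).-homog.
  by have [->|/cb[]//] := eqVneq (b s) 0; apply: rpred0.
have [? ?] : #|s| = i /\ (i <= j)%N.
  have [c0|/cc[]//] := eqVneq (c s) 0.
  by move: nz; rewrite c0 scaler0 add0r => /cb[].
by split=> //; apply: rpredD => //; apply: rpredZ.
Qed.

Lemma koszul_chain0 i j : koszul_chain i j (0 : koszul).
Proof. by move=> s; rewrite ffunE eqxx. Qed.

Lemma koszul_diff_lin a c b s :
  koszul_diff (a *: c + b) s = a *: koszul_diff c s + koszul_diff b s.
Proof.
rewrite !ffunE scaler_sumr -big_split /=; apply: eq_bigr => v _.
by rewrite !ffunE mulrDr scalerAr.
Qed.

Lemma koszul_diff0 s : koszul_diff (0 : koszul) s = 0.
Proof. by rewrite ffunE big1 // => v _; rewrite ffunE mulr0. Qed.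

Lemma koszul_diff_homog d c s : (forall s', c s' \is d.-homog) ->
  koszul_diff c s \is d.+1.-homog.
Proof.
move=> homog_c; rewrite ffunE; apply: rpred_sum => v _.
rewrite -signr_odd mulr_sign -add1n.
suff : 'X_v * c (v |: s) \is (1 + d).-homog.
  by case: odd => //; rewrite mulNr rpredN.
by apply: dhomogM => //; rewrite dhomogX; apply/eqP; exact: mdeg1.
Qed.

Lemma meval_koszul_diff x c s : (koszul_diff c s).@[x] =
  \sum_(v | v \notin s)
     (-1) ^+ #|[set u in s | (u < v)%N]| * x v * (c (v |: s)).@[x].
Proof.
rewrite ffunE raddf_sum; apply: eq_bigr => v _ /=.
by rewrite !mevalM mevalXU rmorphXn rmorphN1.
Qed.

(** The terms for [(v, w)] and [(w, v)] cancel: inserting the smaller index first raises the sign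
    exponent of the larger one by one. *)
Lemma koszul_diff_diff c s : koszul_diff (koszul_diff c) s = 0.
Proof.
pose N v s := #|[set u in s | ((u : 'I_n) < (v : 'I_n))%N]|.
have N1 v w : v \notin s -> N w (v |: s) = ((v < w) + N w s)%N.
  move=> s_v; rewrite /N; case: ltnP => lt_vw.
    have -> : true = (v \notin [set u in s | (u < w)%N]) by rewrite inE (negPf s_v).
    rewrite -cardsU1; apply: eq_card => u; rewrite !inE.
    by case: eqVneq => // ->; rewrite lt_vw.
  apply: eq_card => u; rewrite !inE; case: eqVneq => // ->.
  by rewrite ltnNge lt_vw !andbF.
pose T (p : 'I_n * 'I_n) : S :=
  (-1) ^+ (N p.1 s + N p.2 (p.1 |: s)) * ('X_p.1 * 'X_p.2) * c (p.2 |: (p.1 |: s)).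
pose P (p : 'I_n * 'I_n) := (p.1 \notin s) && (p.2 \notin p.1 |: s).
have -> : koszul_diff (koszul_diff c) s = \sum_(p | P p) T p.
  rewrite ffunE -(pair_big_dep (fun v => v \notin s) (fun v w => w \notin v |: s)
    (fun v w => T (v, w))) /=.
  apply: eq_bigr => v s_v; rewrite ffunE mulr_sumr; apply: eq_bigr => w _.
  by rewrite /T /N /= exprD; ring.
have PC v w : P (v, w) = P (w, v).
  by rewrite /P /= !inE !negb_or [w == v]eq_sym; case: (v \in s) (w \in s) (v == w) => -[] [].
have TC v w : P (v, w) -> (v < w)%N -> T (w, v) = - T (v, w).
  rewrite /P /= !inE !negb_or => /and3P[s_v ne_wv s_w] lt_vw.
  rewrite /T /= !N1 // lt_vw [(w < v)%N]ltnNge (ltnW lt_vw) /= setUCA !exprD expr0 expr1.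
  by ring.
rewrite (bigID (fun p : 'I_n * 'I_n => p.1 < p.2)%N) /=.
rewrite [X in _ + X](reindex_inj (h := fun p : 'I_n * 'I_n => (p.2, p.1))) /=; last first.
  by move=> [v w] [v' w'] /= [-> ->].
rewrite [X in _ + X](eq_bigl (fun p : 'I_n * 'I_n => P p && (p.1 < p.2)%N))
  => [|[v w] /=]; last first.
  rewrite -PC -leqNgt leq_eqVlt; case: eqP => // /val_inj eq_vw.
  by rewrite eq_vw /P /= !inE eqxx andbF.
by rewrite -big_split big1 // => -[v w] /andP[Pvw lt_vw]; rewrite /= (TC v w) // subrr.
Qed.
End Koszul.

(** * Regularity of an ideal of points from divisibility by one variable *)

Section PointIdeal.
Variables (F : finFieldType) (n : nat) (T : Type) (pt : T -> 'I_n -> F).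
Local Notation S := {mpoly F[n]}.
Local Notation koszul := {ffun {set 'I_n} -> S}.
Variables (J : S -> Prop) (v0 : 'I_n) (r : nat) (a : S).
Implicit Types (f g : S) (c b : koszul) (s : {set 'I_n}).

Definition vanishes f := forall t, f.@[pt t] = 0.

Hypotheses (J_vanishes : forall f, J f -> vanishes f)
  (vanishes_J : forall d f, f \is d.-homog -> vanishes f -> J f)
  (v0_min : v0 = 0%N :> nat) (pt_v0 : forall t, pt t v0 != 0)
  (divisible : forall d f, (r < d)%N -> f \is d.-homog ->
     exists2 g, g \is d.-1.-homog & forall t, f.@[pt t] = pt t v0 * g.@[pt t])
  (a_homog : a \is r.-homog)
  (a_indivisible : forall g, (g != 0 -> (0 < r)%N /\ g \is r.-1.-homog) ->
     ~ forall t, a.@[pt t] = pt t v0 * g.@[pt t]).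

Let vanishes_lin x f g : vanishes f -> vanishes g -> vanishes (x *: f + g).
Proof. by move=> vf vg t; rewrite mevalD mevalZ vf vg mulr0 addr0. Qed.

Let vanishes0 : vanishes 0.
Proof. by move=> t; rewrite meval0. Qed.

Lemma chain_homog i j c s : koszul_chain i j c -> c s \is (j - i).-homog.
Proof. by move=> chain_c; have [->|/chain_c[]//] := eqVneq (c s) 0; apply: rpred0. Qed.

(** Coefficients are homogeneous here, and a homogeneous polynomial lies in [J] exactly when it
    vanishes at the points. *)
Let cycleE i j c : koszul_cycle J i j c <->
  koszul_chain i j c /\ forall s, vanishes (koszul_diff c s).
Proof.
split=> -[chain_c dc0]; split=> // s; first exact: J_vanishes.
by apply: vanishes_J (dc0 s); apply: koszul_diff_homog => s'; apply: chain_homog chain_c.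
Qed.

Let boundary_diff_homog i j b s :
  koszul_chain i.+1 j b -> koszul_diff b s \is (j - i).-homog.
Proof.
move=> chain_b; case: (ltnP i j) => [lt_ij|le_ji].
  rewrite -(subnSK lt_ij); apply: koszul_diff_homog => s'; exact: chain_homog chain_b.
have -> : b = 0; last by rewrite koszul_diff0 rpred0.
apply/ffunP => s'; rewrite ffunE; apply/eqP/negP => /negP/chain_b[_].
by rewrite ltnNge le_ji.
Qed.

Let boundaryE i j c : koszul_boundary J i j c <-> koszul_chain i j c /\
  exists2 b, koszul_chain i.+1 j b & forall s, vanishes (c s - koszul_diff b s).
Proof.
split=> -[chain_c [b chain_b db]]; split=> //; exists b => // s.
  exact: J_vanishes.
apply: vanishes_J (db s); apply: rpredB; first exact: chain_homog chain_c.
exact: boundary_diff_homog.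
Qed.

Let cycle_lin i j x c b :
  koszul_cycle J i j c -> koszul_cycle J i j b -> koszul_cycle J i j (x *: c + b).
Proof.
move=> /cycleE[chain_c dc0] /cycleE[chain_b db0]; apply/cycleE; split.
  exact: koszul_chain_lin.
by move=> s; rewrite koszul_diff_lin; apply: vanishes_lin.
Qed.

Let cycle0 i j : koszul_cycle J i j 0.
Proof.
by apply/cycleE; split=> [|s]; [apply: koszul_chain0 | rewrite koszul_diff0].
Qed.

Let boundary_lin i j x c b :
  koszul_boundary J i j c -> koszul_boundary J i j b -> koszul_boundary J i j (x *: c + b).
Proof.
move=> /boundaryE[chain_c [c' chain_c' dc]] /boundaryE[chain_b [b' chain_b' db]].
apply/boundaryE; split; first exact: koszul_chain_lin.
exists (x *: c' + b'); first exact: koszul_chain_lin.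
move=> s; have -> : (x *: c + b) s = x *: c s + b s by rewrite !ffunE.
rewrite koszul_diff_lin opprD addrACA -scalerBr.
exact: vanishes_lin.
Qed.

Let boundary0 i j : koszul_boundary J i j 0.
Proof.
apply/boundaryE; split; first exact: koszul_chain0.
exists 0; first exact: koszul_chain0.
by move=> s; rewrite koszul_diff0 ffunE subr0.
Qed.

Let betti_dim i j :
  is_quotient_dim (koszul_cycle J i j) (koszul_boundary J i j) (betti J i j).
Proof.
apply: epsilon_spec; pose D := 'X_{1..n < (j - i).+1}.
(* A chain is determined by its coefficients of bounded degree, which take finitely many values. *)
pose phi c : {ffun {set 'I_n} -> {ffun D -> F}} := [ffun s => [ffun m : D => (c s)@_m]].
apply: (quotient_dim_exists (@cycle_lin i j) (@boundary_lin i j) (boundary0 i j) (phi := phi));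
  last exact: cycle0.
move=> c b [chain_c _] [chain_b _] eq_phi; apply/ffunP => s; apply/mpolyP => m.
case: (ltnP (mdeg m) (j - i).+1) => [lt_m|gt_m].
  by have /ffunP/(_ s)/ffunP/(_ (BMultinom lt_m)) := eq_phi; rewrite !ffunE.
by rewrite !(dhomog_nemf_coeff (chain_homog s _) (negbT (gtn_eqF gt_m))).
Qed.

(** Above degree [r] the coefficients of a cycle [c] are divisible by [X_v0] on the points; the
    quotient [c'], multiplied by the basis vector of [v0], has boundary [c]. *)
Let betti_eq0 i j : (i + r < j)%N -> betti J i j = 0%N.
Proof.
move=> lt_j; apply: (quotient_dim_eq0 (@boundary_lin i j) (boundary0 i j) (betti_dim i j)).
  exact: cycle0.
move=> c /cycleE[chain_c dc0]; apply/boundaryE; split=> //.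
have [c' c'P] : exists c' : {set 'I_n} -> S, forall s,
    [/\ c' s != 0 -> c s != 0, c' s \is (j - i).-1.-homog &
        forall t, (c s).@[pt t] = pt t v0 * (c' s).@[pt t]].
  suff ex s : exists g, [/\ g != 0 -> c s != 0, g \is (j - i).-1.-homog &
        forall t, (c s).@[pt t] = pt t v0 * g.@[pt t]].
    exists (fun s => proj1_sig (constructive_indefinite_description _ (ex s))) => s.
    by case: constructive_indefinite_description.
  have [->|nz] := eqVneq (c s) 0.
    by exists 0; split; rewrite ?eqxx ?rpred0 // => t; rewrite !meval0 mulr0.
  have [||g homog_g cg] := divisible (d := (j - i)%N) (f := c s); last by exists g.
    by rewrite ltn_subRL.
  exact: chain_homog chain_c.
pose b : koszul := [ffun s : {set 'I_n} => if v0 \in s then c' (s :\ v0) else 0].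
exists b.
  move=> s; rewrite ffunE; case: ifP => [s_v0 nz|_]; last by rewrite eqxx.
  have [/(_ nz)/chain_c[card_s _ _] homog_c' _] := c'P (s :\ v0).
  rewrite (cardsD1 v0) s_v0 card_s; split=> //; first by apply: leq_ltn_trans lt_j; apply: leq_addr.
  by rewrite subnS.
move=> s t; rewrite mevalB meval_koszul_diff; set x := pt t.
have evc s' : (c s').@[x] = x v0 * (c' s').@[x] by have [_ _ ->] := c'P s'.
have [s_v0|s_v0] := boolP (v0 \in s); last first.
  rewrite (bigD1 v0) //= big1 ?addr0 => [|v /andP[s_v ne_v]].
    rewrite ffunE setU11 setU1K // (_ : [set u in s | _] = set0).
      by rewrite cards0 mul1r -evc subrr.
    by apply/setP => u; rewrite !inE v0_min andbF.
  by rewrite ffunE !inE eq_sym (negPf ne_v) (negPf s_v0) meval0 mulr0.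
(* For [v0] in [s], the cycle condition at [s :\ v0] is [X_v0] times the identity sought, and [X_v0]
   is nonzero at every point. *)
have := dc0 (s :\ v0) t; rewrite meval_koszul_diff -/x.
rewrite (bigD1 v0) ?inE ?eqxx //= setD1K //.
rewrite (_ : [set u in s :\ v0 | _] = set0); last first.
  by apply/setP => u; rewrite !inE v0_min andbF.
rewrite cards0 mul1r evc.
have -> : \sum_(v | (v \notin s :\ v0) && (v != v0))
     (-1) ^+ #|[set u in s :\ v0 | (u < v)%N]| * x v * (c (v |: s :\ v0)).@[x]
   = - (x v0 * \sum_(v | v \notin s)
        (-1) ^+ #|[set u in s | (u < v)%N]| * x v * (b (v |: s)).@[x]).
  rewrite mulr_sumr -sumrN; apply: eq_big => [v | v /andP[]].
    by rewrite !inE; case: eqVneq => //= [->|_]; rewrite ?s_v0 ?andbF ?andbT.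
  rewrite !inE => s_v ne_v; rewrite ffunE !inE s_v0 orbT.
  have -> : (v |: s) :\ v0 = v |: s :\ v0.
    apply/setP => u; rewrite !inE; have [->|] := eqVneq u v; first by rewrite ne_v.
    by [].
  rewrite (_ : #|[set u in s | _]| = (#|[set u in s :\ v0 | (u < v)%N]|).+1).
    by rewrite evc exprS; ring.
  rewrite (cardsD1 v0) !inE s_v0 v0_min lt0n -v0_min (inj_eq val_inj) ne_v add1n.
  by congr _.+1; apply: eq_card => u; rewrite !inE andbA.
rewrite -mulrBr => /eqP; rewrite mulf_eq0 (negPf (pt_v0 t)) /=.
by rewrite -evc => /eqP.
Qed.

(* The divisibility of [a X_v] by [X_v0] for every [v] makes the boundary of
   [a e_setT] divisible by [X_v0]; the quotient is a cycle, whose coefficient at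
   [~: [set v0]] is [a]. *)
Let betti_neq0 : betti J n.-1 (n.-1 + r) <> 0%N.
Proof.
have n_gt0 : (0 < n)%N by apply: leq_ltn_trans (ltn_ord v0).
pose e : koszul := [ffun s : {set 'I_n} => if s == setT then a else 0].
have homog_De s : koszul_diff e s \is r.+1.-homog.
  by apply: koszul_diff_homog => s'; rewrite ffunE; case: ifP => // _; apply: rpred0.
have [c' c'P] : exists c' : {set 'I_n} -> S, forall s,
    [/\ c' s != 0 -> koszul_diff e s != 0, c' s \is r.-homog &
        forall t, (koszul_diff e s).@[pt t] = pt t v0 * (c' s).@[pt t]].
  suff ex s : exists g, [/\ g != 0 -> koszul_diff e s != 0, g \is r.-homog &
        forall t, (koszul_diff e s).@[pt t] = pt t v0 * g.@[pt t]].
    exists (fun s => proj1_sig (constructive_indefinite_description _ (ex s))) => s.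
    by case: constructive_indefinite_description.
  have [->|nz] := eqVneq (koszul_diff e s) 0.
    by exists 0; split; rewrite ?eqxx ?rpred0 // => t; rewrite !meval0 mulr0.
  by have [g homog_g eg] := divisible (ltnSn r) (homog_De s); exists g.
pose c : koszul := [ffun s => c' s].
have evc t s : (koszul_diff e s).@[pt t] = pt t v0 * (c s).@[pt t].
  by have [_ _ ->] := c'P s; rewrite [c s]ffunE.
have card_s s : koszul_diff e s != 0 -> #|s| = n.-1.
  apply: contraNeq => card_s; rewrite ffunE big1 // => v s_v; rewrite ffunE.
  case: eqP => [sT|]; last by rewrite mulr0.
  have card_s1 : (#|s|.+1 = n)%N by have := cardsU1 v s; rewrite sT s_v cardsT card_ord.
  by case/eqP: card_s; rewrite -[LHS]/(#|s|.+1.-1) card_s1.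
have chain_c : koszul_chain n.-1 (n.-1 + r) c.
  move=> s; rewrite ffunE => nz; have [/(_ nz)/card_s-> homog_c' _] := c'P s.
  by rewrite leq_addr addKn.
have dc0 s : vanishes (koszul_diff c s).
  move=> t; have := meval_koszul_diff (pt t) (koszul_diff e) s.
  rewrite koszul_diff_diff meval0; under eq_bigr do rewrite evc mulrCA.
  rewrite -mulr_sumr -meval_koszul_diff => /esym/eqP.
  by rewrite mulf_eq0 (negPf (pt_v0 t)) => /eqP.
move=> betti0; have := betti_dim n.-1 (n.-1 + r); rewrite betti0.
case=> x [_ /(_ c)] []; first by apply/cycleE.
move=> k0 [/boundaryE[_ [b chain_b db]] _].
apply: (a_indivisible (g := b setT)).
  by case/chain_b => _ le_r; rewrite subnS addKn; split=> //; lia.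
move=> t; pose s0 := [set~ v0].
have diff_s0 d : (koszul_diff d s0).@[pt t] = pt t v0 * (d setT).@[pt t].
  rewrite meval_koszul_diff (big_pred1 v0) => [|v]; last by rewrite !inE negbK.
  rewrite (_ : [set u in s0 | _] = set0) ?cards0 ?mul1r ?setUCr //.
  by apply/setP => u; rewrite !inE v0_min andbF.
have := db s0 t; rewrite mevalB diff_s0 big_ord0 subr0 => /eqP; rewrite subr_eq0 => /eqP <-.
by apply: (mulfI (pt_v0 t)); rewrite -evc diff_s0 ffunE eqxx.
Qed.

(** Betti numbers vanish for [j - i > r], and one with [j - i = r] is nonzero in homological degree
    [n.-1]. Two solutions of [is_regularity] coincide, so [epsilon] returns [r]. *)
Lemma regularity_point_ideal : regularity J = r.
Proof.
have reg_r : is_regularity J r.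
  split; first by exists n.-1.
  by move=> i j; rewrite leqNgt => nz; apply/negP => /betti_eq0.
have [[i nz_i] le_reg] : is_regularity J (regularity J) by apply: epsilon_spec; exists r.
have [[i' nz_i'] le_r] := reg_r.
by have := le_r _ _ nz_i; have := le_reg _ _ nz_i'; lia.
Qed.

End PointIdeal.

(** * Regularity of a graph as a covering radius *)

Section UnitPowerSums.
Variables (K : finFieldType) (k : nat).
Hypothesis card_K : #|K| = k.+3.

Lemma unit_expf (b : K) : b != 0 -> b ^+ k.+2 = 1.
Proof. by move=> nz_b; apply: (mulfI nz_b); rewrite -exprS -card_K expf_card mulr1. Qed.

Lemma expf_Zp (b : K) (m m' : nat) :
  b != 0 -> (m%:R : 'Z_k.+2) = m'%:R -> b ^+ m = b ^+ m'.
Proof.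
move=> nz_b /eqP; rewrite Zp_natr_eq => /eqP eq_m.
by rewrite -(expr_mod m (unit_expf nz_b)) eq_m expr_mod ?unit_expf.
Qed.

Lemma card_units : #|[pred b : K | b != 0]| = k.+2.
Proof. by have := cardC1 (0 : K); rewrite card_K => /= <-; apply: eq_card. Qed.

(** With the exponent reduced modulo q - 1, the polynomial [X^e - 1] has fewer roots than there are
    units. *)
Lemma unit_expf_neq1 (e : nat) :
  (e%:R : 'Z_k.+2) != 0 -> exists2 b : K, b != 0 & b ^+ e != 1.
Proof.
move=> nz_e; apply: NNPP => no_b.
have all1 (b : K) : b != 0 -> b ^+ (e %% k.+2) = 1.
  move=> nz_b; rewrite expr_mod ?unit_expf //.
  by apply/eqP/negPn/negP => ne1; case: no_b; exists b.
have d_gt0 : (0 < e %% k.+2)%N.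
  by rewrite lt0n; move: nz_e; rewrite -[0]/(0%:R) Zp_natr_eq mod0n.
have := @max_poly_roots K ('X^(e %% k.+2) - 1%:P) (enum [pred b : K | b != 0]).
rewrite -cardE card_units size_XnsubC // -size_poly_eq0 size_XnsubC // enum_uniq.
move=> /(_ isT); rewrite ltnS leqNgt ltn_pmod //= => /(_ _ isT).
suff -> : all (root ('X^(e %% k.+2) - 1%:P)) (enum [pred b : K | b != 0]) by move/(_ isT).
apply/allP => b; rewrite mem_enum inE => nz_b.
by rewrite /root !hornerE all1 // subrr.
Qed.

(** Rescaling the summation variable by a unit [g] multiplies the sum by [g ^+ e], and [g] can be
    chosen with [g ^+ e != 1]. *)
Lemma sum_unit_expf (e : nat) :
  (e%:R : 'Z_k.+2) != 0 -> \sum_(b : K | b != 0) b ^+ e = 0.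
Proof.
case/unit_expf_neq1=> g nz_g; set s := (X in X = 0).
rewrite -subr_eq0 => nz; suff /eqP : (g ^+ e - 1) * s = 0.
  by rewrite mulf_eq0 (negPf nz) => /eqP.
rewrite mulrBl mul1r mulr_sumr; apply/eqP; rewrite subr_eq0 /s; apply/eqP.
rewrite [RHS](reindex_inj (mulfI nz_g)) /=.
by apply: eq_big => [b | b _]; rewrite ?exprMn // mulf_eq0 (negPf nz_g).
Qed.

Lemma card_finField_natr : (k.+3)%:R = 0 :> K.
Proof.
by have := expg_cardG (in_setT (1 : K) : 1 \in [set: K]%G); rewrite cardsT card_K FinRing.zmodXgE.
Qed.

Variable V : finType.

(** A character of the torus summed over all its points, nonzero only for the trivial character; it
    separates monomials of different weights. *)
Definition torus_sum (e : V -> nat) : K :=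
  \sum_(a in ffun_on [pred b : K | b != 0] : {pred {ffun V -> K}}) \prod_x a x ^+ e x.

Lemma torus_sumE e : torus_sum e = \prod_x \sum_(b : K | b != 0) b ^+ e x.
Proof. by rewrite bigA_distr_big. Qed.

Lemma torus_sum_eq0 e x : ((e x)%:R : 'Z_k.+2) != 0 -> torus_sum e = 0.
Proof. by move=> nz; rewrite torus_sumE (bigD1 x) //= sum_unit_expf // mul0r. Qed.

Lemma torus_sum_neq0 e : (forall x, ((e x)%:R : 'Z_k.+2) = 0) -> torus_sum e != 0.
Proof.
move=> e0; rewrite torus_sumE; apply/prodf_neq0 => x _.
rewrite (eq_bigr (fun=> 1)) => [|b nz_b]; last by rewrite (expf_Zp (m' := 0) nz_b (e0 x)) expr0.
(* There are q - 1 units, and q - 1 is [-1] in [K]. *)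
rewrite sumr_const -[#|_|]/(#|[pred b : K | b != 0]|) card_units.
have := card_finField_natr; rewrite -natr1 => /eqP; rewrite addr_eq0 => /eqP->.
by rewrite oppr_eq0 oner_eq0.
Qed.
End UnitPowerSums.

(** * Regularity from the covering radius of the weight map *)

Section GraphRegularityFormula.
Variables (K : finFieldType) (k : nat) (V : finType) (G : graph V).
Local Notation Z := 'Z_k.+2.
Local Notation n := #|eset G|.
Local Notation word := (seq ({set V} * Z)).
Hypotheses (card_K : #|K| = k.+3)
  (inG : forall e, e \in eset G -> e \subset vset G)
  (grG : graded k (eset G)) (eset_gt0 : (0 < n)%N).

Let ends (i : 'I_n) : {set V} := enum_val i.
Let torus := {a : V -> K | forall x, a x != 0}.
Let pt (t : torus) (i : 'I_n) : K := \prod_(x in ends i) sval t x.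
(** Index 0 makes the Koszul signs at [v0] trivial. *)
Let v0 : 'I_n := Ordinal eset_gt0.

Let multiplicity (m : 'X_{1..n}) (x : V) : nat := \sum_(i | x \in ends i) m i.

Let pt_neq0 t i : pt t i != 0.
Proof. by apply/prodf_neq0 => x _; apply: (svalP t). Qed.

Let meval_monomial t m : 'X_[m].@[pt t] = \prod_x sval t x ^+ multiplicity m x.
Proof.
rewrite mevalX.
have ptX i : pt t i ^+ m i = \prod_x (if x \in ends i then sval t x ^+ m i else 1).
  by rewrite -big_mkcond prodrXl.
rewrite (eq_bigr _ (fun i _ => ptX i)).
rewrite exchange_big; apply: eq_bigr => x _ /=.
by rewrite -big_mkcond /= expr_sum.
Qed.

Let mweight (m : 'X_{1..n}) (x : V) : Z := (multiplicity m x)%:R.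

Let mweightE m x : mweight m x = \sum_(i | x \in ends i) (m i)%:R.
Proof. exact: natr_sum. Qed.

Let mweightD m m' x : mweight (m + m')%MM x = mweight m x + mweight m' x.
Proof. by rewrite !mweightE -big_split; apply: eq_bigr => i _ /=; rewrite mnmDE natrD. Qed.

Let mweight1 i x : mweight U_(i)%MM x = (x \in ends i)%:R.
Proof.
rewrite mweightE big_mkcond (bigD1 i) //= big1 => [|j /negPf ne_ji].
  by rewrite mnm1E eqxx addr0; case: ifP.
by rewrite mnm1E eq_sym ne_ji; case: ifP.
Qed.

Let mweight_period q i x : mweight (U_(i) *+ (q * k.+2))%MM x = 0.
Proof.
rewrite mweightE big1 // => j _; rewrite mulmnE mulnA natrM.
have -> : k.+2%:R = 0 :> Z by apply/eqP; rewrite -[0]/(0%:R) Zp_natr_eq modnn mod0n.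
by rewrite mulr0.
Qed.

Let meval_mweight m m' t : mweight m =1 mweight m' -> 'X_[m].@[pt t] = 'X_[m'].@[pt t].
Proof.
move=> eq_m; rewrite !meval_monomial; apply: eq_bigr => x _.
by apply: (expf_Zp card_K); [apply: (svalP t) | apply: eq_m].
Qed.

Let word_of (m : 'X_{1..n}) : word := [seq (ends i, (m i)%:R) | i <- enum 'I_n].

Let over_word_of m : over (eset G) (word_of m).
Proof. by apply/allP => _ /mapP[i _ ->]; apply: enum_valP. Qed.

Let weight_word_of m : weight (word_of m) =1 mweight m.
Proof. by move=> x; rewrite mweightE /weight big_map big_enum_cond. Qed.

Let wsum_word_of m : wsum (word_of m) = (mdeg m)%:R.
Proof. by rewrite mdegE natr_sum /wsum big_map big_enum. Qed.

Let wcost_word_of m : (wcost (word_of m) <= mdeg m)%N.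
Proof.
rewrite mdegE /wcost /lcost /unzip2 /word_of 2!big_map big_enum /=; apply: leq_sum => i _.
exact: val_Zp_natr_le.
Qed.

(** Exponents are sums of least representatives, so the degree equals the cost. *)
Let mon (w : word) : 'X_{1..n} := [multinom \sum_(a <- w | a.1 == ends i) val a.2 | i < n]%N.

Let sum_ends (A : nmodType) (Q : {set V} -> bool) (h : {set V} * Z -> A) w :
  over (eset G) w ->
  \sum_(i | Q (ends i)) \sum_(a <- w | a.1 == ends i) h a = \sum_(a <- w | Q a.1) h a.
Proof.
move=> w_G; rewrite (exchange_big_dep predT) //= big_seq [RHS]big_seq_cond big_mkcondr.
apply: eq_bigr => a a_w; have e_G : a.1 \in eset G := allP w_G a a_w.
have ends_a : ends (enum_rank_in e_G a.1) = a.1 by apply: enum_rankK_in.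
rewrite (eq_bigl (fun i => Q a.1 && (i == enum_rank_in e_G a.1))) => [|i].
  by case: (Q a.1); rewrite ?big_pred1_eq ?big_pred0_eq.
rewrite -{1}ends_a (inj_eq enum_val_inj) eq_sym.
by case: eqP => [->|]; rewrite ?andbF // ends_a.
Qed.

Let mweight_mon w : over (eset G) w -> mweight (mon w) =1 weight w.
Proof.
move=> w_G x; rewrite mweightE /weight -(sum_ends (fun e => x \in e)) //.
by apply: eq_bigr => i _; rewrite mnmE natr_sum; apply: eq_bigr => a _; rewrite natr_Zp.
Qed.

Let mdeg_mon w : over (eset G) w -> mdeg (mon w) = wcost w.
Proof.
move=> w_G; rewrite mdegE /wcost /lcost /unzip2 big_map -(sum_ends predT (fun a => val a.2)) //.
by apply: eq_bigr => i _; rewrite mnmE.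
Qed.

Let wcost_natr (w : word) : (wcost w)%:R = wsum w.
Proof. by rewrite /wcost lcost_natr /wsum /unzip2 big_map. Qed.

Let ends_in i : ends i \in eset G. Proof. exact: enum_valP. Qed.

Let reduces_bound : reduces k (eset G) (n * k.+1).
Proof.
move=> w w_G; exists (word_of (mon w)).
split; [exact: over_word_of | by move=> z; rewrite addr0 weight_word_of mweight_mon |].
rewrite /wcost /unzip2; apply: leq_trans (lcost_le _) _.
by rewrite 2!size_map size_enum_ord.
Qed.

Let J_vanishes (f : {mpoly K[n]}) : vanishing_ideal f -> vanishes pt f.
Proof.
case=> m [h [g [g_van ->]]] t; rewrite raddf_sum big1 // => i _ /=.
have [_ /(_ (sval t))] := g_van i; rewrite mevalM => g0.
by rewrite [X in _ * X]g0 ?mulr0 // => x _; apply: (svalP t).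
Qed.

Let vanishes_J d (f : {mpoly K[n]}) :
  f \is d.-homog -> vanishes pt f -> vanishing_ideal f.
Proof.
move=> homog_f f_van; exists 1%N, (fun=> 1), (fun=> f); split; last first.
  by rewrite big_ord1 mul1r.
move=> _; split; first by exists d.
(* Only values on [vset G] are known to be nonzero; setting the others to 1 gives a point of the
   torus with the same edge products. *)
move=> a a_nz; pose a' x := if x \in vset G then a x else 1.
have a'_nz x : a' x != 0 by rewrite /a'; case: ifP => [/a_nz//|_]; apply: oner_neq0.
rewrite -[RHS](f_van (exist _ a' a'_nz)); apply: meval_eq => i; apply: eq_bigr => x x_i.
by rewrite /a' /= (subsetP (inG (ends_in i))).
Qed.
Let wsum_reach (w w' : word) : over (eset G) w -> over (eset G) w' ->
  (forall z, weight w' z + 0 = weight w z) -> wsum w' = wsum w.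
Proof. by move=> w_G w'_G bal; apply: grG => // z; rewrite -bal addr0. Qed.

Let single (x : Z) : word := [:: (ends v0, x)].

Let over_cat_single w x : over (eset G) w -> over (eset G) (w ++ single x).
Proof. by move=> w_G; rewrite over_cat w_G /= ends_in. Qed.

Let weight_cat_single w x z :
  weight (w ++ single x) z = weight w z + (z \in ends v0)%:R * x.
Proof. by rewrite weight_cat weight_cons weight_nil addr0. Qed.

Let wsum_cat_single w x : wsum (w ++ single x) = wsum w + x.
Proof. by rewrite wsum_cat /wsum /single big_seq1. Qed.

(* Padding a word by full periods of one edge realises its weight by a
   monomial of any prescribed larger degree in the right residue class. *)
Let padded w d : over (eset G) w -> (wcost w <= d)%N -> wsum w = d%:R ->
  exists2 m, mdeg m = d & mweight m =1 weight w.
Proof.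
move=> w_G le_d; rewrite -wcost_natr => /eqP; rewrite Zp_natr_eq.
rewrite eq_sym eqn_mod_dvd // => /dvdnP[q def_q].
exists (mon w + U_(v0) *+ (q * k.+2))%MM.
  by rewrite mdegD mdegMn mdeg1 mdeg_mon // mul1n -def_q subnKC.
by move=> x; rewrite mweightD mweight_period addr0 mweight_mon.
Qed.

Lemma reduces_regularity B : reduces k (eset G) B <-> (reg K G + k.+1 <= B)%N.
Proof.
have [|M redM minM] := @ex_min_nat (reduces k (eset G)).
  by exists (n * k.+1)%N; apply: reduces_bound.
have reach_mod (w : word) c : over (eset G) w -> reaches (eset G) w (fun=> 0) c ->
    exists w', [/\ over (eset G) w', weight w' =1 weight w, (wcost w' <= c)%N &
      wsum w' = wsum w].
  move=> w_G [y [y_G bal_y cost_y]]; exists y; split=> //.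
    by move=> z; rewrite -bal_y addr0.
  exact: (wsum_reach w_G y_G bal_y).
(* Weights determine degrees modulo [k.+2], so exceeding [d] by less than one period is excluded
   altogether. *)
have close c d : (c%:R = d%:R :> Z) -> (c < d + k.+2)%N -> (c <= d)%N.
  move=> /eqP; rewrite Zp_natr_eq => eq_cd lt_c; rewrite leqNgt; apply/negP => lt_dc.
  have : (k.+2 %| c - d)%N by rewrite -eqn_mod_dvd // ltnW.
  by move/dvdn_leq; rewrite subn_gt0 => /(_ lt_dc); lia.
(* A single label [-1] forces a cost congruent to [-1], hence at least [k.+1]; so [M - k.+1] is not
   truncated. *)
have M_ge : (k.+1 <= M)%N.
  have s_G : over (eset G) (single (-1)) by rewrite /= ends_in.
  have [w [w_G _ cost_w sum_w]] := reach_mod _ _ s_G (redM _ s_G).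
  apply: leq_trans cost_w; rewrite -ltnS ltnNge; apply/negP => le_w.
  have : (wcost w).+1%:R == 0%:R :> Z.
    by rewrite -natr1 wcost_natr sum_w /wsum big_seq1 addrC subrr.
  by rewrite Zp_natr_eq mod0n -/(k.+2 %| _)%N => /dvdn_leq; lia.
set r := (M - k.+1)%N; have def_M : M = (r + k.+1)%N by rewrite subnK.
have [w0 [w0_G w0_min]] : exists w0 : word, over (eset G) w0 /\ forall w,
    over (eset G) w -> weight w =1 weight w0 -> (M <= wcost w)%N.
  apply: NNPP => no_w; have /minM : reduces k (eset G) M.-1; last by lia.
  move=> w w_G; apply: NNPP => no_reach; case: no_w; exists w; split=> // w' w'_G eq_w'.
  rewrite leqNgt; apply/negP => lt_M; case: no_reach; exists w'; split=> //.
    by move=> z; rewrite addr0.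
  by rewrite -ltnS prednK //; lia.
have sum_w0 : wsum w0 = M%:R.
  have [w [w_G eq_w cost_w <-]] := reach_mod _ _ w0_G (redM _ w0_G).
  by rewrite -wcost_natr; congr _%:R; apply/eqP; rewrite eqn_leq cost_w w0_min.
(* Adding the edge of [v0] to the worst word [w0] makes the degree congruent to [M + 1], that is to
   [r]; a cost of at most [M], less than [r + k.+2], is then at most [r]. *)
have [ma deg_a weight_a] : exists2 m, mdeg m = r &
    forall x, mweight m x = weight w0 x + (x \in ends v0)%:R.
  have w1_G := over_cat_single 1 w0_G.
  have [w [w_G eq_w cost_w sum_w]] := reach_mod _ _ w1_G (redM _ w1_G).
  have sum_w_r : wsum w = r%:R.
    rewrite sum_w wsum_cat_single sum_w0 natr1; apply/eqP.
    by rewrite Zp_natr_eq def_M -addnS modnDr.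
  have [||m deg_m eq_m] := @padded w r w_G.
  - apply: close; first by rewrite wcost_natr.
    by rewrite addnS -def_M ltnS.
  - exact: sum_w_r.
  by exists m => // x; rewrite eq_m eq_w weight_cat_single mulr1.
(* After removing one edge of [v0] the degree is congruent to [d.-1], and the reduced cost is at
   most [M], below [d.-1 + k.+2]; padding then reaches degree [d.-1]. *)
have div_mon m d : (r < d)%N -> mdeg m = d ->
    exists2 m', mdeg m' = d.-1 & forall t, 'X_[m].@[pt t] = pt t v0 * 'X_[m'].@[pt t].
  move=> lt_rd deg_m; have w1_G := over_cat_single (-1) (over_word_of m).
  have [w [w_G eq_w cost_w sum_w]] := reach_mod _ _ w1_G (redM _ w1_G).
  have d_gt0 : (0 < d)%N by apply: leq_ltn_trans lt_rd.
  have sum_w_d : wsum w = d.-1%:R.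
    by rewrite sum_w wsum_cat_single wsum_word_of deg_m -(prednK d_gt0) -natr1 addrK.
  have [||m' deg_m' eq_m'] := @padded w d.-1 w_G.
  - by apply: close; [rewrite wcost_natr | lia].
  - exact: sum_w_d.
  exists m' => // t; rewrite -[pt t v0]mevalXU -mevalM -mpolyXD; apply: meval_mweight => x.
  rewrite mweightD mweight1 eq_m' eq_w weight_cat_single weight_word_of.
  by rewrite mulrN1 addrCA subrr addr0.
suff -> : reg K G = r.
  rewrite -def_M; split=> [|le_MB w w_G]; first exact: minM.
  exact: reaches_sub le_MB (redM w w_G).
apply: (@regularity_point_ideal _ _ _ pt _ v0 r 'X_[ma]) => //.
- move=> d f lt_rd homog_f.
  have [h hP] : exists h : 'X_{1..n} -> 'X_{1..n}, forall m, mdeg m = d ->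
      mdeg (h m) = d.-1 /\ forall t, 'X_[m].@[pt t] = pt t v0 * 'X_[h m].@[pt t].
    have ex m : exists m', mdeg m = d ->
        mdeg m' = d.-1 /\ forall t, 'X_[m].@[pt t] = pt t v0 * 'X_[m'].@[pt t].
      have [deg_m|] := eqVneq (mdeg m) d; last by move/eqP=> ne_d; exists m => /ne_d.
      by have [m' ? ?] := div_mon m d lt_rd deg_m; exists m'.
    exists (fun m => proj1_sig (constructive_indefinite_description _ (ex m))) => m.
    by case: constructive_indefinite_description.
  exists (\sum_(m <- msupp f) f@_m *: 'X_[h m]).
    rewrite big_seq; apply: rpred_sum => m m_f; apply: rpredZ; rewrite dhomogX.
    by apply/eqP; apply: (hP m _).1; apply: (dhomogP _ _ _ homog_f).
  move=> t; rewrite {1}[f]mpolyE !raddf_sum mulr_sumr big_seq [RHS]big_seq.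
  apply: eq_bigr => m m_f /=; rewrite !mevalZ mulrCA; congr (_ * _).
  by apply: (hP m _).2; apply: (dhomogP _ _ _ homog_f).
- by rewrite dhomogX; apply/eqP; exact: deg_a.
move=> g homog_g eq_a.
(* As [k.+1] is [-1] modulo [k.+2], this is the character of [m] divided by that of [ma]. Summing
   [eq_a] against it gives a nonzero left side, while every monomial of [g] will contribute 0. *)
pose e (m : 'X_{1..n}) x := (multiplicity m x + k.+1 * multiplicity ma x)%N.
have char_sum m : \sum_(a in ffun_on [pred b : K | b != 0] : {pred {ffun V -> K}})
    (\prod_x a x ^+ multiplicity m x) * (\prod_x a x ^+ multiplicity ma x) ^+ k.+1
  = torus_sum K (e m).
  apply: eq_bigr => a _; rewrite -prodrXl -big_split; apply: eq_bigr => x _ /=.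
  by rewrite exprD mulnC exprM.
have : torus_sum K (e ma) == 0; last first.
  apply/negP; apply: (torus_sum_neq0 card_K) => x; rewrite /e -mulSn natrM.
  have -> : k.+2%:R = 0 :> Z by apply/eqP; rewrite -[0]/(0%:R) Zp_natr_eq modnn mod0n.
  by rewrite mul0r.
rewrite -char_sum.
have monomialE m (a : {ffun V -> K}) (nz : forall x, a x != 0) :
    \prod_x a x ^+ multiplicity m x = 'X_[m].@[pt (exist _ (fun x => a x) nz)].
  by rewrite meval_monomial.
have ffun_onE (a : {ffun V -> K}) : a \in ffun_on [pred b : K | b != 0] -> forall x, a x != 0.
  by move=> /ffun_onP nz x; apply: nz.
rewrite (eq_bigr (fun a : {ffun V -> K} => \sum_(m <- msupp g) g@_m *
  ((\prod_x a x ^+ multiplicity (U_(v0) + m)%MM x)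
    * (\prod_x a x ^+ multiplicity ma x) ^+ k.+1))) => [|a /ffun_onE nz]; last first.
  rewrite {1}(monomialE _ _ nz) eq_a {1}[g]mpolyE raddf_sum mulr_sumr mulr_suml.
  apply: eq_bigr => m _ /=; rewrite (monomialE (U_(v0) + m)%MM _ nz) mpolyXD mevalM.
  by rewrite mevalZ mevalXU; ring.
rewrite exchange_big big_seq big1 // => m m_g; rewrite -mulr_sumr char_sum.
have nz_g : g != 0 by apply: contraTneq m_g => ->; rewrite msupp0.
have [r_gt0 /dhomogP/(_ m m_g) deg_m] := homog_g nz_g.
(* A weight different from that of [ma] gives the sum 0. With equal weights, [m] would have the
   weight of [w0] and degree [r.-1], below the minimal cost [M]. *)
have [x nz_x|eq_m] := pickP (fun x => mweight (U_(v0) + m)%MM x != mweight ma x).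
  rewrite (torus_sum_eq0 card_K (x := x)) ?mulr0 //; apply: contraNneq nz_x.
  rewrite /e natrD natrM -natr1 => e0; rewrite -subr_eq0; apply/eqP.
  have k1 : (k%:R + 1 : Z) = -1.
    apply/eqP; rewrite -subr_eq0 opprK natr1 natr1 -[0]/(0%:R).
    by rewrite Zp_natr_eq modnn mod0n.
  by move: e0; rewrite k1 mulN1r.
have /(w0_min _ (over_word_of m)) : weight (word_of m) =1 weight w0.
  move=> x; rewrite weight_word_of; apply: (addIr ((x \in ends v0)%:R : Z)).
  by rewrite -weight_a -(eqP (negbFE (eq_m x))) mweightD mweight1 addrC.
have := wcost_word_of m; rewrite [mdeg m]deg_m; lia.
Qed.
End GraphRegularityFormula.

(** * Comparison of regularities *)

Definition edges_in (V : finType) (G : graph V) := forall e, e \in eset G -> e \subset vset G.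

(** * Vertex counts of modified graphs *)

Section GraphModifications.
Variables (V : finType) (G : graph V) (p : V * seq V).
Hypothesis ear_p : open_ear G p.

Lemma vset_remove_ear : vset (remove_ear G p) = vset G :\: path_inner p.
Proof.
rewrite /remove_ear; case: ifP => // le1.
have -> : path_inner p = set0; last by rewrite setD0.
by case: p le1 => u [|x [|y l]] //= _; apply/setP => z; rewrite !inE.
Qed.

Lemma edges_in_remove_ear : edges_in G -> edges_in (remove_ear G p).
Proof.
move=> inG e; rewrite vset_remove_ear => e_r; apply/subsetP => x x_e; rewrite inE.
apply/andP; split; first by apply: contraL x_e => x_p; apply: remove_ear_inner e_r.
have : e \in eset G by rewrite (open_ear_eset ear_p) inE e_r.
by move/inG/subsetP; apply.
Qed.

Lemma card_path_inner : #|path_inner p| = (path_length p).-1.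
Proof.
have := open_ear_uniq ear_p; rewrite lastI rcons_uniq => /andP[_ uniq_b].
rewrite cardsE (card_uniqP _) ?size_behead ?size_belast //.
by move: uniq_b; case: belast => //= x l /andP[].
Qed.

Lemma path_length_gt0 : (0 < path_length p)%N.
Proof. by case: ear_p => -[/andP[]]. Qed.

Hypothesis inG : edges_in G.

Lemma path_sub_vset x : x \in p.1 :: p.2 -> x \in vset G.
Proof.
have sub_v e : e \in path_edges p -> {subset e <= vset G}.
  by move/(open_ear_sub ear_p)/inG/subsetP.
have := path_length_gt0; rewrite /path_length; case: p sub_v => u l /=.
elim: l u => // y l IHl u sub_v _; rewrite in_cons => /orP[/eqP->|x_yl].
  by apply: (sub_v [set u; y]); rewrite ?mem_head // !inE eqxx.
have [l0|l_gt0] := posnP (size l); last first.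
  by apply: (IHl y _ l_gt0 x_yl) => e e_l; apply: sub_v; rewrite in_cons e_l orbT.
apply: (sub_v [set u; y]); rewrite ?mem_head // !inE.
by move: x_yl; rewrite (size0nil l0) inE => ->; rewrite orbT.
Qed.

Lemma path_ends_vset x : x \in path_ends p -> x \in vset (remove_ear G p).
Proof.
move=> x_ends; rewrite vset_remove_ear inE; apply/andP; split.
  have := pred0P (path_inner_ends (open_ear_uniq ear_p)) x.
  by rewrite /= x_ends andbT => ->.
apply: path_sub_vset; move: x_ends; rewrite !inE => /orP[/eqP->|/eqP->].
  exact: mem_head.
exact: mem_last.
Qed.

Lemma card_vset_remove_ear :
  (#|vset (remove_ear G p)| + path_length p = #|vset G|.+1)%N.
Proof.
rewrite vset_remove_ear cardsD (setIidPr _); last first.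
  apply/subsetP => x; rewrite inE => /mem_behead/mem_belast/path_sub_vset; exact.
have le_c : (#|path_inner p| <= #|vset G|)%N.
  apply/subset_leq_card/subsetP => x; rewrite inE => /mem_behead/mem_belast/path_sub_vset; exact.
by rewrite card_path_inner in le_c *; have := path_length_gt0; lia.
Qed.

Lemma card_vset_replace m :
  (#|vset (replace_ear G p m)| + path_length p = #|vset G| + m.+1)%N.
Proof.
rewrite /= cardsU (_ : _ :&: _ = set0); last first.
  by apply/setP => z; rewrite !inE; apply/negP => /andP[/imsetP[x _ ->] /imsetP[]].
rewrite cards0 subn0 card_imset ?card_imset; [|exact: inr_inj | exact: inl_inj].
by rewrite card_ord; have := card_vset_remove_ear; lia.
Qed.

Lemma edges_in_replace m : edges_in (replace_ear G p m).
Proof.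
move=> e; rewrite inE => /orP[/imsetP[e' e'_r ->]|].
  apply: subset_trans (imsetS _ (edges_in_remove_ear inG e'_r)) _.
  exact: subsetUl.
rewrite inE => e_q; apply/subsetP => z z_e; have := path_edge_sub e_q z_e.
rewrite in_cons mem_rcons in_cons inE.
have in_ends x : x \in path_ends p -> (inl x : V + 'I_m) \in vset (replace_ear G p m).
  by move=> /path_ends_vset x_v; rewrite inE imset_f.
case/or3P=> [/eqP->|/eqP->|/mapP[i _ ->]].
- by have := in_ends (path_first p); rewrite !inE eqxx; apply.
- by have := in_ends (path_last p); rewrite !inE eqxx orbT; apply.
by rewrite (imset_f inr) ?orbT // inE.
Qed.

Lemma card_vset_identify :
  (#|vset (identify (remove_ear G p) (path_first p) (path_last p))| + path_length p
     = #|vset G|)%N.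
Proof.
have [_ ne_ends] := ear_p.
have [u_v v_v] : path_first p \in vset (remove_ear G p) /\ path_last p \in vset (remove_ear G p).
  by split; apply: path_ends_vset; rewrite !inE eqxx ?orbT.
rewrite /= (_ : [set _ | x in _] = vset (remove_ear G p) :\ path_last p).
  by have := card_vset_remove_ear; rewrite (cardsD1 (path_last p)) v_v; lia.
apply/setP => z; rewrite !inE; apply/imsetP/andP => [[x x_v ->]|[ne_zv z_v]].
  by case: (eqVneq x (path_last p)) => [_|ne_x]; split.
by exists z; rewrite ?(negPf ne_zv).
Qed.

Lemma edges_in_identify : edges_in (identify (remove_ear G p) (path_first p) (path_last p)).
Proof.
by move=> _ /imsetP[e e_r ->]; apply/imsetS/edges_in_remove_ear.
Qed.

End GraphModifications.

Lemma graded_sub k (V : finType) (E1 E2 : {set {set V}}) :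
  {subset E1 <= E2} -> graded k E2 -> graded k E1.
Proof. by move=> sE grE w w' w_E w'_E; apply: grE; apply: over_sub sE _. Qed.

(** Clears the denominator and the possibly negative difference of vertex numbers. *)
Lemma regularity_shift_nat (a b x y c : nat) :
  a%:R = b%:R + (x%:R - y%:R) / 2%:R * c%:R :> rat ->
  (2 * a + y * c = 2 * b + x * c)%N.
Proof.
move=> def_a; apply/eqP; rewrite -(eqr_nat rat) !natrD !natrM def_a; apply/eqP.
by field.
Qed.

Local Close Scope ring_scope.

Theorem theorem3p4 (K : finFieldType) (q : nat) (card_K : #|K| = q)
    (q_gt2 : 2 < q) (V : finType) (G : graph V)
    (simpleG : simple_graph G) (no_isolG : no_isolated_vertex G)
    (bipG : bipartite G) (I P : V * seq V)
    (earI : open_ear G I) (earP : open_ear G P)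
    (same_ends : path_ends I = path_ends P)
    (hypI : ear_modification_hypothesis K (remove_ear G P) I) :
  reg K G = reg K (remove_ear G P) + (path_length P)./2 * (q - 2).
Proof.
have [k def_q] : exists k, q = k.+3 by exists (q - 3); lia.
rewrite def_q in card_K *; have -> : (k.+3 - 2 = k.+1) by rewrite !subSS subn0.
set H := remove_ear G P in hypI *.
have [earH regH] := hypI; set R := eset (remove_ear H I).
have uniqI := open_ear_uniq earI; have uniqP := open_ear_uniq earP.
have [_ ne_ends] := earI.
have eset_H : eset H = R :|: [set e in path_edges I] := open_ear_eset earH.
have eset_G : eset G = R :|: [set e in path_edges I] :|: [set e in path_edges P].
  by rewrite -eset_H; apply: open_ear_eset.
have inner_I := remove_ear_inner (G := H) (p := I).
have inner_P := remove_ear_inner (G := G) (p := P); rewrite -/H eset_H in inner_P.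
(* Both parities are read off from the colours of the common end-vertices. *)
have eq_odd : odd (path_length I) = odd (path_length P).
  have [c bip_c] := bipG.
  have cI := path_color bip_c (open_ear_sub earI).
  have cP := path_color bip_c (open_ear_sub earP).
  have : path_first I \in path_ends P by rewrite -same_ends !inE eqxx.
  have : path_last I \in path_ends P by rewrite -same_ends !inE eqxx orbT.
  move: ne_ends cI; rewrite !inE => ne cI /orP[]/eqP eL /orP[]/eqP eF; move: ne cI cP;
  by rewrite ?eL ?eF ?eqxx // => _ -> ; case: (c _) (odd _) (odd _) => -[] [].
have inG : edges_in G by move=> e /simpleG[].
have inH : edges_in H := edges_in_remove_ear earP inG.
have grG : graded k (eset G) by apply: graded_bipartite.
have grH : graded k (eset H).
  by apply: graded_sub grG => e; rewrite (open_ear_eset earP) inE => ->.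
have reg_replace m : odd m.+1 = odd (path_length I) ->
    (2 * reg K (replace_ear H I m) + path_length I * k.+1
       = 2 * reg K H + m.+1 * k.+1).
  move=> odd_m; have := regH _ _ (EarReplaced H odd_m).
  rewrite card_K -(addn2 k.+1) (natrD _ k.+1 2) addrK => /regularity_shift_nat.
  by have := card_vset_replace earH inH m; nia.
have pathI_gt0 := path_length_gt0 earI.
have regE W (G' : graph W) p : (0 < path_length p) ->
    {subset path_edges p <= eset G'} -> edges_in G' -> graded k (eset G') ->
    forall B, reduces k (eset G') B <-> (reg K G' + k.+1 <= B).
  move=> p_gt0 sub_p inG' grG' B; apply: reduces_regularity => //; apply/card_gt0P.
  exists (head set0 (path_edges p)); apply: sub_p.
  by case: p p_gt0 => u [|x l] //= _; apply: mem_head.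
have regG := regE _ G I pathI_gt0 (open_ear_sub earI) inG grG.
have regJ m : odd m.+1 = odd (path_length I) -> forall B,
    reduces k (replaced_edges R I m) B <-> (reg K (replace_ear H I m) + k.+1 <= B).
  move=> odd_m; apply: (regE _ (replace_ear H I m) (new_path I m)).
  - by rewrite /path_length size_rcons.
  - by move=> e e_q; rewrite !inE e_q orbT.
  - exact: edges_in_replace.
  - by apply: graded_replaced; rewrite -?eset_H.
apply/eqP; rewrite eqn_leq; apply/andP; split.
  (* The new ear has [m.+1] edges, that is [(path_length P)./2.*2] more than [I], so the hypothesis
     raises the regularity of [H] by exactly the amount claimed. *)
  set m := (path_length I + (path_length P)./2.*2).-1.
  have def_m : m.+1 = (path_length I + (path_length P)./2.*2).
    by rewrite prednK // addn_gt0 pathI_gt0.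
  have odd_m : odd m.+1 = odd (path_length I) by rewrite def_m oddD odd_double addbF.
  have /regJ := leqnn (reg K (replace_ear H I m) + k.+1) => /(_ odd_m) red_m.
  have /regG : reduces k (eset G) (reg K (replace_ear H I m) + k.+1).
    by rewrite eset_G; apply: reduces_merge.
  by rewrite leq_add2r; have := reg_replace m odd_m; rewrite def_m; nia.
have redG : reduces k (eset G) (reg K G + k.+1) by apply/regG.
rewrite eset_G in redG.
have [odd_I|even_I] := boolP (odd (path_length I)).
  have [le_d] := reduces_odd uniqI uniqP ne_ends same_ends eq_odd inner_I inner_P odd_I redG.
  (* Replacing [I] by one edge lowers the regularity of [H] by the share of [I] in the bound; the
     share of [P] is what remains. *)
  have odd_1 : odd 1 = odd (path_length I) by rewrite odd_I.
  move/(regJ 0%N odd_1); have := reg_replace 0%N odd_1.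
  have := odd_double_half (path_length I); rewrite odd_I -muln2; nia.
have [le_d red_w] := reduces_even uniqI uniqP ne_ends same_ends eq_odd inner_I inner_P even_I redG.
(* The ends of an even ear have the same colour, so no edge joins them. *)
have uv_R e : e \in R -> ~~ ((path_first I \in e) && (path_last I \in e)).
  move=> e_R; apply/negP => /andP[u_e v_e]; have [c bip_c] := bipG.
  have e_G : e \in eset G by rewrite eset_G !inE e_R.
  have : c (path_first I) != c (path_last I).
    apply: bip_c; suff -> : [set path_first I; path_last I] = e by [].
    apply/eqP; rewrite eqEcard (simpleG _ e_G).2 cards2 ne_ends andbT.
    by apply/subsetP => x; rewrite !inE => /orP[]/eqP->.
  by rewrite (path_color bip_c (open_ear_sub earI)) (negPf even_I) addbF eqxx.
have [R0|[e e_R]] := set_0Vmem R.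
  (* Now [G] is a cycle; replacing [I] by ears of lengths 2 and 4 contradicts [hypI]. *)
  have odd_2 : odd 2 = odd (path_length I) by rewrite (negPf even_I).
  have odd_4 : odd 4 = odd (path_length I) by rewrite (negPf even_I).
  have : reduces k (replaced_edges R I 1) (2 * k.+1).
    by rewrite R0; apply/reduces_replaced_set0.
  move/(regJ 1%N odd_2); have := (regJ 3%N odd_4 _).2 (leqnn _).
  rewrite R0 => /(reduces_replaced_set0 _ _ ne_ends odd_4).
  (* Length 2 gives regularity at most [k.+1], length 4 at least [3 * k.+1], whereas the hypothesis
     makes them differ by [k.+1]. *)
  by have := reg_replace 1%N odd_2; have := reg_replace 3%N odd_4; nia.
pose D := identify (remove_ear H I) (path_first I) (path_last I).
have D_gt0 : (0 < #|eset D|) by apply/card_gt0P; eexists; apply: imset_f e_R.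
have inD : edges_in D := edges_in_identify earH inH.
have grD : graded k (eset D) by apply: graded_identified; rewrite -?eset_H.
have : reduces k (eset D) (reg K G + k.+1 - ((path_length I)./2 + (path_length P)./2) * k.+1).
  exact: reduces_identified red_w.
move/(reduces_regularity card_K inD grD D_gt0).
(* Identification loses [path_length I] vertices, hence lowers the regularity of [H] by
   [(path_length I)./2 * k.+1], again the share of [I]. *)
have := regH _ _ (EarIdentified H even_I); rewrite -/D.
rewrite card_K -(addn2 k.+1) (natrD _ k.+1 2) addrK => /regularity_shift_nat.
rewrite -(card_vset_identify earH inH) -/D mulnDl.
have : (path_length I * k.+1 = (path_length I)./2 * k.+1 * 2).
  by rewrite mulnAC muln2 even_halfK.
move: le_d; rewrite !mulnDl; move: (_./2 * k.+1) (_./2 * k.+1) => x y.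
by move: (_ * k.+1) (_ * k.+1) => z t; lia.
Qed.
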